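(* Let $m,n\ge 1$ be integers, let $1<p_{1},\dots,p_{m}<\infty$ and let $p$ be defined by $\frac{1}{p}=\sum_{i=1}^{m}\frac{1}{p_{i}}$. Then there exists a positive constant $C$ such that the following holds for every $m$-tuple $\vec{\omega}=(\omega_{1},\dots,\omega_{m})$ of arbitrary weights on $\mathbb{R}^n$, every $m$-tuple $\vec f=(f_1,\dots,f_m)$ of locally integrable functions on $\mathbb{R}^n$ and every $t>0$ (so $C$ does not depend on the $\omega_j$ and $f_j$). Put $\nu_{\vec{\omega}}=\prod_{j=1}^{m}\omega_{j}^{p/p_{j}}$ and $W_{j}=M_{\mathcal{R}}M_{\mathcal{R}}^{n-1}\cdots M_{\mathcal{R}}^{1}\omega_{j}$ for $j=1,\dots,m$. Then $$\nu_{\vec{\omega}}\left(\left\{x\in\mathbb{R}^{n}:\mathcal{M}_{\mathcal{R}}(\vec{f})(x)>t^{m}\right\}\right)^{1/p}\leq \prod_{j=1}^{m}\frac{C}{t}\|f_{j}\|_{L^{p_{j}}(\mathbb{R}^{n},W_{j})}.$$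
   Context: A weight is a nonnegative locally integrable function on $\mathbb{R}^n$; for a weight $\nu$ and measurable set $E$, $\nu(E)=\int_{E}\nu\,dx$. For a $[0,\infty]$-valued measurable function $W$, $\|f\|_{L^{q}(\mathbb{R}^n,W)}=\left(\int_{\mathbb{R}^n}|f|^{q}W\,dx\right)^{1/q}$ (with $0\cdot\infty=0$). $\mathcal{R}$ is the family of all rectangles in $\mathbb{R}^n$ with sides parallel to the coordinate axes. The multilinear strong maximal function is $\mathcal{M}_{\mathcal{R}}(\vec{f})(x)=\sup_{R\in\mathcal{R},\,R\ni x}\prod_{j=1}^{m}\frac{1}{|R|}\int_{R}|f_{j}(y)|\,dy$. For $c=1,\dots,n$, $\mathcal{R}_{c}$ is the set of all rectangles in $\mathbb{R}^n$ with sides parallel to the coordinate axes and having complexity $c$, i.e. rectangles for which there are $\alpha_1,\dots,\alpha_c>0$ such that every side length is one of $\alpha_1,\dots,\alpha_c$, where $\alpha_1,\dots,\alpha_c$ vary over all positive numbers (a $c$-parameter family; $\mathcal{R}_1$ is the set of cubes and $\mathcal{R}_n=\mathcal{R}$). The strong maximal operator with complexity $c$ is $M_{\mathcal{R}}^{c}f(x)=\sup_{R\in\mathcal{R}_{c},\,R\ni x}\frac{1}{|R|}\int_{R}|f(y)|\,dy$, and $M_{\mathcal{R}}=M_{\mathcal{R}}^{n}$ is the strong maximal operator. These operators are applied to $[0,\infty]$-valued functions in the obvious way. In $W_j$ the operators $M_{\mathcal{R}}^{1},M_{\mathcal{R}}^{2},\dots,M_{\mathcal{R}}^{n-1},M_{\mathcal{R}}^{n}=M_{\mathcal{R}}$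 are applied successively in this order to $\omega_j$ (for $n=1$, $W_j=M_{\mathcal{R}}\omega_j$). *)

(* Defs.v *)
From HB Require Import structures.
From mathcomp Require Import all_boot all_order all_algebra.
From mathcomp Require Import all_classical all_reals all_analysis.

Set Implicit Arguments.
Unset Strict Implicit.
Unset Printing Implicit Defensive.

Import Order.TTheory GRing.Theory Num.Theory.
Import numFieldNormedType.Exports.

Local Open Scope classical_set_scope.
Local Open Scope ring_scope.

(* Borel sets of R^n: the product sigma-algebra on 'rV[R]_n. *)
Definition borelRn_display : measure_display.
Proof. exact: default_measure_display. Qed.

Section BorelRn.
Context {R : realType}.

Definition coordRn n (i : 'I_n) (x : 'rV[R]_n) : measurableTypeR R := x ord0 i.

Let borelRn0 n : g_sigma_preimage (@coordRn n) set0.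
Proof. exact: sigma_algebra0. Qed.

Let borelRnC n A :
  g_sigma_preimage (@coordRn n) A -> g_sigma_preimage (@coordRn n) (~` A).
Proof. exact: sigma_algebraC. Qed.

Let borelRn_bigcup n (F : (set 'rV[R]_n)^nat) :
  (forall i, g_sigma_preimage (@coordRn n) (F i)) ->
  g_sigma_preimage (@coordRn n) (\bigcup_i F i).
Proof. exact: sigma_algebra_bigcup. Qed.

HB.instance Definition _ n := @isMeasurable.Build borelRn_display
  'rV[R]_n (g_sigma_preimage (@coordRn n))
  (@borelRn0 n) (@borelRnC n) (@borelRn_bigcup n).

Lemma measurable_coord n (i : 'I_n) : measurable_fun setT (@coordRn n i).
Proof.
move=> _ Y mY; rewrite setTI; apply: sub_sigma_algebra => /=.
rewrite -bigcup_seq/=; exists i => /=; first by rewrite mem_index_enum.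
by exists Y => //; rewrite setTI.
Qed.

Definition consRn n (z : measurableTypeR R * 'rV[R]_n) : 'rV[R]_n.+1 :=
  row_mx (z.1 : R)%:M z.2.

Lemma measurable_fun_coord d (T : measurableType d) n (f : T -> 'rV[R]_n) :
  (forall i, measurable_fun setT (@coordRn n i \o f)) -> measurable_fun setT f.
Proof.
move=> mf _ Y mY; rewrite setTI.
suff : preimage_set_system setT f (g_sigma_preimage (@coordRn n)) `<=` measurable.
  by apply; exists Y => //; rewrite setTI.
rewrite -g_sigma_preimage_comp.
apply: smallest_sub; first exact: sigma_algebra_measurable.
by rewrite -bigcup_seq/= => A [i _ [B mB <-]]; exact: mf.
Qed.

Lemma consRn0 n z : coordRn ord0 (@consRn n z) = z.1.
Proof.
rewrite /coordRn /consRn (_ : ord0 = lshift n (ord0 : 'I_1)); last exact/val_inj.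
by rewrite (@row_mxEl _ _ 1 n) mxE eqxx mulr1n.
Qed.

Lemma consRn_lift n z (j : 'I_n) :
  coordRn (lift ord0 j) (@consRn n z) = coordRn j z.2.
Proof. by rewrite /coordRn /consRn -rshift1 (@row_mxEr _ _ 1 n). Qed.

Lemma measurable_consRn n : measurable_fun setT (@consRn n).
Proof.
apply: measurable_fun_coord => i.
case: (unliftP ord0 i) => [j ->|->].
  rewrite (_ : _ \o _ = @coordRn n j \o snd).
    by apply: measurableT_comp => //; exact: measurable_coord.
  by apply/funext => z /=; exact: consRn_lift.
rewrite (_ : _ \o _ = fst)//; apply/funext => z /=; exact: consRn0.
Qed.

End BorelRn.

Section LebesgueRn.
Context {R : realType}.
Local Open Scope ereal_scope.

Section step.
Variables (n : nat) (mu : {sigma_finite_measure set 'rV[R]_n -> \bar R}).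

Definition lebesgue_step : set 'rV[R]_n.+1 -> \bar R :=
  pushforward (lebesgue_measure \x mu) (@consRn R n).

Let step0 : lebesgue_step set0 = 0.
Proof. by rewrite /lebesgue_step /pushforward preimage_set0 measure0. Qed.

Let step_ge0 A : 0 <= lebesgue_step A.
Proof. by rewrite /lebesgue_step /pushforward; exact: measure_ge0. Qed.

Let step_sigma_additive : semi_sigma_additive lebesgue_step.
Proof.
move=> F mF tF mUF.
pose m := @lebesgue_measure R \x mu.
apply: (@measure_semi_sigma_additive _ _ _ (pushforward m (@consRn R n))) => //.
exact: measurable_consRn.
Qed.

HB.instance Definition _ := isMeasure.Build _ _ _ lebesgue_step
  step0 step_ge0 step_sigma_additive.

Let step_sigma_finite : sigma_finite setT lebesgue_step.
Proof.
have /sigma_finiteP[F [TF ndF Foo]] := sigma_finiteT (@lebesgue_measure R).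
have /sigma_finiteP[G [TG ndG Goo]] := sigma_finiteT mu.
pose tl (x : 'rV[R]_n.+1) : 'rV[R]_n := (\row_j x ord0 (lift ord0 j))%R.
have mtl : measurable_fun setT tl.
  apply: measurable_fun_coord => i.
  rewrite (_ : _ \o _ = coordRn (lift ord0 i)); first exact: measurable_coord.
  by apply/funext => x; rewrite /= /coordRn mxE.
exists (fun k => coordRn ord0 @^-1` F k `&` tl @^-1` G k).
  rewrite predeqE => x; split => // _.
  have [i _ Fi] : (\bigcup_i F i) (coordRn ord0 x) by rewrite -TF.
  have [j _ Gj] : (\bigcup_j G j) (tl x) by rewrite -TG.
  exists (maxn i j) => //; split.
  - by move/subsetPset: (ndF _ _ (leq_maxl i j)); apply.
  - by move/subsetPset: (ndG _ _ (leq_maxr i j)); apply.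
move=> k; have [mF Fk] := Foo k; have [mG Gk] := Goo k.
split.
  apply: measurableI; rewrite -[X in measurable X]setTI; last exact: mtl.
  exact: measurable_coord.
rewrite /lebesgue_step /pushforward (_ : _ @^-1` _ = F k `*` G k); last first.
  rewrite predeqE => -[a b]; rewrite /preimage/= consRn0/=.
  rewrite (_ : tl _ = b)//; apply/rowP => j; rewrite mxE.
  exact: consRn_lift.
by rewrite product_measure1E// lte_mul_pinfty// ge0_fin_numE.
Qed.

HB.instance Definition _ := Measure_isSigmaFinite.Build _ _ _ lebesgue_step
  step_sigma_finite.

End step.

Fixpoint borel_lebesgue n : {sigma_finite_measure set 'rV[R]_n -> \bar R} :=
  match n with
  | 0 => \d_ (0%R : 'rV[R]_0)
  | n'.+1 => lebesgue_step (borel_lebesgue n')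
  end.

End LebesgueRn.

(* Lebesgue measure on R^n: the completion of the n-fold product measure.  The
   carrier Rn is convertible to 'rV[R]_n, but its measurable sets are all the
   Lebesgue measurable sets rather than the Borel ones. *)
Section Lebesgue.
Context {R : realType} {n : nat}.

Definition Rn : measurableType _ :=
  caratheodory_type (mu_ext (@borel_lebesgue R n)).

Definition lebesgueRn : set Rn -> \bar R :=
  @completed_measure_extension _ _ R (borel_lebesgue n).

HB.instance Definition _ := Measure.on lebesgueRn.

End Lebesgue.
Arguments Rn : clear implicits.

Section Weights.
Context {R : realType} {n : nat}.
Implicit Types (f w : 'rV[R]_n -> R).
Local Notation mu := (@lebesgueRn R n).

Definition locally_integrableRn f :=
  measurable_fun [set: Rn R n] f /\
  forall K : set 'rV[R]_n, compact K ->
    (\int[mu]_(x in K) `|f x|%:E < +oo)%E.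

Definition weight w := (forall x, 0 <= w x) /\ locally_integrableRn w.

Definition weight_measure w (E : set 'rV[R]_n) : \bar R :=
  (\int[mu]_(x in E) (w x)%:E)%E.

Definition weighted_norm (q : R) (W : 'rV[R]_n -> \bar R) f : \bar R :=
  ((\int[mu]_x ((`|f x| `^ q)%:E * W x)) `^ q^-1)%E.

End Weights.

(* Open rectangles; closed ones yield the same maximal functions. *)
Definition rectangle {R : realType} {n : nat} (a b : 'rV[R]_n) :
    set 'rV[R]_n :=
  [set x | forall i, a ord0 i < x ord0 i < b ord0 i].

Section RectangleVolume.
Context {R : realType} {n : nat}.

Lemma borel_lebesgue_rectangle (m : nat) (a b : 'rV[R]_m) : (forall i, a ord0 i <= b ord0 i) ->
  measurable (rectangle a b) /\
  borel_lebesgue m (rectangle a b) = (\prod_i (b ord0 i - a ord0 i))%:E.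
Proof.
elim: m a b => [|m IH] a b ab.
  rewrite big_ord0 (_ : rectangle a b = setT); last by rewrite predeqE => x; split => // _ [].
  split; first exact: measurableT.
  by rewrite /= diracT.
pose a' : 'rV[R]_m := (\row_j a ord0 (lift ord0 j)).
pose b' : 'rV[R]_m := (\row_j b ord0 (lift ord0 j)).
have [|mI eI] := IH a' b'; first by move=> i; rewrite !mxE.
split.
  rewrite (_ : rectangle a b = \bigcap_(i in [set: 'I_m.+1]) (coordRn i @^-1` [set` `]a ord0 i, b ord0 i[ ])).
    apply: fin_bigcap_measurable => //= i _.
    rewrite -[X in measurable X]setTI; apply: measurable_coord => //.
  rewrite predeqE => x; split => [h i _|h i]; rewrite /coordRn /=; first by rewrite in_itv/= h.
  by have := h i I; rewrite /= in_itv.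
rewrite /= /lebesgue_step /pushforward.
rewrite (_ : _ @^-1` _ = [set` `]a ord0 ord0, b ord0 ord0[ ] `*` rectangle a' b').
  rewrite product_measure1E; [|exact: measurable_itv|exact: mI].
  rewrite [X in (X * _)%E](_ : _ = (b ord0 ord0 - a ord0 ord0)%:E); last first.
    rewrite [LHS](@lebesgue_measure_itv R)/= lte_fin.
    have := ab ord0; rewrite le_eqVlt => /orP[/eqP->|->]; last by rewrite EFinB.
    by rewrite ltxx subrr.
  rewrite [X in (_ * X)%E](_ : _ = (\prod_i (b' ord0 i - a' ord0 i))%:E); last exact: eI.
  rewrite -EFinM big_ord_recl.
  by congr ((_ * _)%:E); apply: eq_bigr => i _; rewrite !mxE.
rewrite predeqE => -[u v]; split => /=.
  move=> h; split => /=.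
    rewrite in_itv/=; have := h ord0; have := consRn0 (u,v); rewrite /coordRn => -> //.
  by move=> i; have := h (lift ord0 i); have := consRn_lift (u,v) i; rewrite /coordRn !mxE => -> //.
move=> [/=]; rewrite in_itv/= => h0 h i.
case: (unliftP ord0 i) => [j ->|->].
  by have := h j; have := consRn_lift (u,v) j; rewrite /coordRn !mxE => -> //.
by have := consRn0 (u,v); rewrite /coordRn => -> //.
Qed.

Lemma lebesgueRn_rectangle (a b : 'rV[R]_n) : (forall i, a ord0 i <= b ord0 i) ->
  lebesgueRn (rectangle a b) = (\prod_i (b ord0 i - a ord0 i))%:E.
Proof.
move=> /borel_lebesgue_rectangle[mab <-].
by rewrite /lebesgueRn /completed_measure_extension measurable_mu_extE.
Qed.

End RectangleVolume.

Section StrongMaximal.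
Context {R : realType} {n : nat}.
Local Notation mu := (@lebesgueRn R n).
Implicit Types (a b x : 'rV[R]_n) (Q : set 'rV[R]_n) (f : 'rV[R]_n -> \bar R).

Definition rectangles : set (set 'rV[R]_n) :=
  [set Q | exists a b, (forall i, a ord0 i < b ord0 i) /\ Q = rectangle a b].

(* The side lengths need not exhaust the alpha k. *)
Definition rectangles_complexity (c : nat) : set (set 'rV[R]_n) :=
  [set Q | exists a b, [/\ forall i, a ord0 i < b ord0 i, Q = rectangle a b &
    exists alpha : 'I_c -> R, (forall k, 0 < alpha k) /\
      forall i, exists k, b ord0 i - a ord0 i = alpha k]].

Definition average f Q : \bar R :=
  ((mu Q)^-1 * \int[mu]_(y in Q) `|f y|)%E.

Definition strong_maximal (c : nat) f x : \bar R :=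
  ereal_sup [set average f Q | Q in [set Q | rectangles_complexity c Q /\ Q x]].

(* The operators of complexity 1, 2, ..., n applied in this order. *)
Definition iterated_maximal f : 'rV[R]_n -> \bar R :=
  foldl (fun g c => strong_maximal c g) f (iota 1 n).

Definition multilinear_maximal m (f : 'I_m -> 'rV[R]_n -> R) x : \bar R :=
  ereal_sup [set (\prod_(j < m) average (EFin \o f j) Q)%E |
    Q in [set Q | rectangles Q /\ Q x]].

End StrongMaximal.

Definition product_weight (R : realType) (n m : nat) (p : R) (ps : 'I_m -> R)
    (w : 'I_m -> 'rV[R]_n -> R) (x : 'rV[R]_n) : R :=
  \prod_(j < m) w j x `^ (p / ps j).

(* Main.v *)
(* Write v_c = M^c ... M^1 w.  By induction on c one shows
     (B_c)   int_{D_c(A)} w <= C int_A v_c,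
   where D_c(A) is the union of the rectangles of complexity c at least half of
   which lies in A (and D_0(A) = A).  Given finitely many rectangles of
   complexity c + 1, sorted by their longest side, select greedily those that
   are at most half covered by the previously selected ones.  Each rectangle R
   is then half covered by selected ones whose longest side is at least as
   long; shrinking R in its longest directions lowers the complexity and shows
   that R lies in D_c(A), where A is the union of the triples 3R of the selected
   rectangles.
   So by (B_c) the w-measure of the union is at most C times the sum of the
   v_c(3R), with R ranging over a sparse family.

   If prod_j avg_R f_j >= 1 on that family, Hoelder's inequality gives
     v_c(3R) <= |3R| prod_j (avg_{3R} v_{c,j})^{p/p_j} (avg_R f_j)^p
              <= |3R| prod_j (avg_R (f_j v_{c+1,j}^{1/p_j}))^p,
   and sparseness, Hoelder's inequality and the unweighted strong maximal
   theorem bound the sum over R by prod_j (int f_j^{p_j} v_{c+1,j})^{p/p_j}.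
   This gives both (B_{c+1}), with m = 1 and f = 2 1_A, and the theorem, with
   c + 1 = n. *)

Require Import Defs.
From HB Require Import structures.
From mathcomp Require Import all_boot all_order all_algebra.
From mathcomp Require Import all_classical all_reals all_analysis.
From mathcomp Require Import measurable_realfun perm ring lra.

Set Implicit Arguments.
Unset Strict Implicit.
Unset Printing Implicit Defensive.

Import Order.TTheory GRing.Theory Num.Theory.
Import numFieldNormedType.Exports.

Local Open Scope classical_set_scope.
Local Open Scope ring_scope.

(** * Hoelder's inequality *)

(** The selection compares rectangles by their longest side only; about the shorter sides nothing is
    known, so an unselected rectangle need not lie in the triples of the selected ones. Shrinking
    avoids the comparison: in the longest directions the triples absorb the displacement, in the
    other directions nothing moves. What remains is a rectangle with one parameter fewer, left to
    (B_c). For a cube only a point remains, whence D_0(A) = A. Each parameter thus costs one maximal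
    operator.

    Rectangles can be compared only if their longest sides point in the same directions. Families
    are therefore split according to which parameter each side uses, at the price of a factor (c +
    1)^n.

    Sorting and selecting require finite lists, so all bounds, the strong maximal theorem included,
    are uniform over finite lists; a Lindelof argument for open rectangles then reaches arbitrary
    unions.

    Maximal functions of weights may be infinite, so functions take values in [0, +oo]. The theorem
    concerns Lebesgue measurable functions while Tonelli's theorem is applied to Borel ones; Borel
    hulls mediate. *)

Section GenericIntegral.
Context d (T : measurableType d) (R : realType).
Variable mu : {measure set T -> \bar R}.
Local Open Scope ereal_scope.

Lemma emeasurable_prod (D : set T) m (F : 'I_m -> T -> \bar R) :
  (forall j, measurable_fun D (F j)) ->
  measurable_fun D (fun x => \prod_(j < m) F j x).
Proof.
elim: m F => [|m IH] F mF.
  rewrite (_ : (fun _ => _) = cst 1); first exact: measurable_cst.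
  by apply/funext => x; rewrite big_ord0.
rewrite (_ : (fun _ => _) = (F ord0 \* (fun x => \prod_(j < m) F (lift ord0 j) x))).
  by apply: emeasurable_funM; [exact: mF|by apply: IH => j; exact: mF].
by apply/funext => x; rewrite big_ord_recl.
Qed.

Lemma emeasurable_powR (D : set T) (f : T -> \bar R) (r : R) :
  measurable_fun D f -> measurable_fun D (fun x => f x `^ r).
Proof. by move=> mf; exact: (measurableT_comp (measurable_poweR (R := R) r) mf). Qed.

Lemma prode_fin m (x : 'I_m -> \bar R) : (forall j, x j \is a fin_num) ->
  \prod_(j < m) x j = (\prod_(j < m) fine (x j))%:E.
Proof.
move=> h; elim: m x h => [|m IH] x h; first by rewrite !big_ord0.
by rewrite !big_ord_recl IH// EFinM fineK.
Qed.

Lemma prode_eq0 m (x : 'I_m -> \bar R) j : x j = 0 -> \prod_(i < m) x i = 0.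
Proof. by move=> h; rewrite (bigD1 j)//= h mul0e. Qed.

Lemma le_prode m (x y : 'I_m -> \bar R) : (forall j, 0 <= x j) ->
  (forall j, x j <= y j) -> \prod_(j < m) x j <= \prod_(j < m) y j.
Proof.
move=> x0 xy; suff /andP[] : 0 <= \prod_(j < m) x j <= \prod_(j < m) y j by [].
elim/big_rec2: _ => [|j u v _ /andP[v0 vu]]; first by rewrite lee01 lexx.
by rewrite mule_ge0//= lee_pmul.
Qed.

Lemma poweR_prod m (x : 'I_m -> \bar R) (r : R) : (forall j, 0 <= x j) ->
  (\prod_(j < m) x j) `^ r = \prod_(j < m) x j `^ r.
Proof.
move=> x0; suff /andP[_ /eqP] : (0 <= \prod_(j < m) x j) &&
   ((\prod_(j < m) x j) `^ r == \prod_(j < m) x j `^ r) by [].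
elim/big_rec2: _ => [|j u v _ /andP[v0 /eqP vu]]; first by rewrite lee01 poweR1r/=.
by rewrite mule_ge0//= poweRM// vu.
Qed.

(* By [ln y <= y - 1] at [y = x j / s], with [s] the right-hand side. *)
Lemma amgm_real m (th x : 'I_m -> R) : (forall j, 0 < th j)%R ->
  (\sum_(j < m) th j = 1)%R -> (forall j, 0 <= x j)%R ->
  (\prod_(j < m) x j `^ th j <= \sum_(j < m) th j * x j)%R.
Proof.
move=> th0 th1 x0.
have s0 : (0 <= \sum_(j < m) th j * x j)%R.
  by apply: sumr_ge0 => j _; rewrite mulr_ge0// ltW.
have [[j xj0]|xn0] := pselect (exists j, x j = 0%R).
  by rewrite (bigD1 j)//= xj0 powR0 ?mul0r// gt_eqF.
have {}x0 j : (0 < x j)%R.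
  by rewrite lt_neqAle x0 andbT eq_sym; apply/eqP => xj; apply: xn0; exists j.
set s := (\sum_(j < m) th j * x j)%R in s0 *.
have {}s0 : (0 < s)%R.
  rewrite lt_neqAle s0 andbT eq_sym psumr_eq0; last first.
    by move=> j _; rewrite mulr_ge0// ltW.
  apply/negP => /allP h.
  move: th1; rewrite big1 => [/eqP|j _]; first by rewrite eq_sym oner_eq0.
  by have := h j (mem_index_enum _); rewrite mulf_eq0 (gt_eqF (x0 j)) orbF => /eqP.
have e : (\prod_(j < m) x j `^ th j = expR (\sum_(j < m) th j * ln (x j)))%R.
  by rewrite expR_sum; apply: eq_bigr => j _; rewrite /powR gt_eqF.
rewrite e -ler_ln ?posrE ?expR_gt0// expRK -subr_le0.
have -> : (\sum_(j < m) th j * ln (x j) - ln s = \sum_(j < m) th j * (ln (1 + (x j / s - 1))))%R.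
  rewrite -[X in (_ - X)%R]mul1r -[X in (_ - X * _)%R]th1 mulr_suml -sumrB; apply: eq_bigr => j _.
  by rewrite (addrC 1%R) subrK ln_div ?posrE// mulrBr.
apply: (@le_trans _ _ (\sum_(j < m) th j * (x j / s - 1))%R).
  apply: ler_sum => j _; rewrite ler_wpM2l ?(ltW (th0 j))// le_ln1Dx//.
  by rewrite ltrBrDl subrr divr_gt0.
under eq_bigr do rewrite mulrBr mulr1 mulrA.
by rewrite sumrB th1 -mulr_suml -/s divff ?gt_eqF// subrr.
Qed.

Lemma poweRK (x : \bar R) (r : R) : (r != 0)%R -> 0 <= x -> (x `^ r) `^ r^-1 = x.
Proof. by move=> r0 x0; rewrite -poweRrM mulfV// poweRe1. Qed.

Lemma lee_poweR (x y : \bar R) (r : R) : (0 <= r)%R -> 0 <= x -> x <= y ->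
  x `^ r <= y `^ r.
Proof.
move=> r0 x0 xy; apply: gt0_ler_poweR => //; rewrite in_itv/= leey andbT//.
exact: le_trans xy.
Qed.

(** Divide each [F j] by its integral: pointwise weighted AM-GM then bounds the product by a linear
    combination of the [F j] whose integral is the right-hand side, the [th j] having sum 1.
    Degenerate integrals come first: one that vanishes makes the product vanish almost everywhere,
    and if none vanishes, an infinite one makes the right-hand side infinite. *)
Lemma holder_prod m (th : 'I_m -> R) (F : 'I_m -> T -> \bar R) (D : set T) :
  measurable D -> (forall j, 0 < th j)%R -> (\sum_(j < m) th j = 1)%R ->
  (forall j, measurable_fun D (F j)) -> (forall j x, 0 <= F j x) ->
  \int[mu]_(x in D) (\prod_(j < m) F j x `^ th j) <=
    \prod_(j < m) (\int[mu]_(x in D) F j x) `^ th j.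
Proof.
move=> mD th0 th1 mF F0.
have I0 j : 0 <= \int[mu]_(x in D) F j x by exact: integral_ge0.
have mP : measurable_fun D (fun x => \prod_(j < m) F j x `^ th j).
  by apply: emeasurable_prod => j; exact: emeasurable_powR.
have P0 x : 0 <= \prod_(j < m) F j x `^ th j.
  by apply: prode_ge0 => j _; exact: poweR_ge0.
have [[j ij0]|ino0] := pselect (exists j, \int[mu]_(x in D) F j x = 0).
  rewrite (ge0_ae_eq_integral (g := cst 0))//.
    by rewrite integral0; apply: prode_ge0 => k _; exact: poweR_ge0.
  have : ae_eq mu D (F j) (cst 0).
    apply/ae_eq_integral_abs => //; rewrite -ij0; apply: eq_integral => x _.
    by rewrite gee0_abs.
  apply: filterS => x /= h Dx; rewrite (prode_eq0 (j := j))// h//.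
  by rewrite poweR0r// gt_eqF.
have {}I0 j : 0 < \int[mu]_(x in D) F j x.
  by rewrite lt_neqAle I0 andbT eq_sym; apply/eqP => xj; apply: ino0; exists j.
have [[j ijy]|inoy] := pselect (exists j, \int[mu]_(x in D) F j x = +oo).
  rewrite [leRHS](_ : _ = +oo) ?leey// (bigD1 j)//= ijy poweRyr ?gt_eqF//.
  rewrite gt0_mulye//.
  by elim/big_ind: _ => // [x y x0 y0|i _]; [exact: mule_gt0|exact: poweR_gt0].
have Ifin j : \int[mu]_(x in D) F j x \is a fin_num.
  rewrite ge0_fin_numE ?ltW// lt_neqAle leey andbT.
  by apply/eqP => xj; apply: inoy; exists j.
pose i j := fine (\int[mu]_(x in D) F j x).
have i0 j : (0 < i j)%R.
  by rewrite fine_gt0// I0/=; move: (Ifin j); rewrite ge0_fin_numE ?ltW.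
have iE j : \int[mu]_(x in D) F j x = (i j)%:E by rewrite fineK.
set c := \prod_(j < m) _.
have cE : c = \prod_(j < m) (i j `^ th j)%:E.
  by apply: eq_bigr => j _; rewrite iE.
have c0 : 0 <= c by apply: prode_ge0 => k _; exact: poweR_ge0.
have pw x : \prod_(j < m) F j x `^ th j <= c * \sum_(j < m) (th j / i j)%:E * F j x.
  have t0 j : 0 <= (th j / i j)%:E * F j x.
    by rewrite mule_ge0// lee_fin divr_ge0// ltW.
  have [[j fy]|fny] := pselect (exists j, F j x = +oo).
    rewrite [leRHS](_ : _ = +oo) ?leey//.
    rewrite (_ : \sum_(j < m) _ = +oo).
      rewrite gt0_muley// cE.
      elim/big_ind: _ => // [u v u0 v0|k _]; first exact: mule_gt0.
      by rewrite lte_fin powR_gt0.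
    apply/eqP; rewrite esum_eqy.
      by apply/existsP; exists j; rewrite /= fy gt0_muley// lte_fin divr_gt0.
    by move=> k _; rewrite gt_eqF// (lt_le_trans _ (t0 k)).
  have fF j : F j x \is a fin_num.
    rewrite ge0_fin_numE// lt_neqAle leey andbT.
    by apply/eqP => xj; apply: fny; exists j.
  rewrite [leRHS](_ : _ = (\prod_(j < m) (i j `^ th j) *
       \sum_(j < m) th j * (fine (F j x) / i j))%:E).
    rewrite [leLHS](_ : _ = (\prod_(j < m) fine (F j x) `^ th j)%:E); last first.
      rewrite prode_fin; last by move=> j; exact: fin_num_poweR.
      by congr EFin; apply: eq_bigr => j _; rewrite fine_poweR.
    rewrite lee_fin.
    apply: (@le_trans _ _ (\prod_(j < m) i j `^ th j *
        \prod_(j < m) (fine (F j x) / i j) `^ th j)%R).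
      rewrite -big_split/=; apply: ler_prod => j _; rewrite powR_ge0/=.
      rewrite -powRM ?(ltW (i0 j))//; last by apply: divr_ge0; [exact: fine_ge0|exact: ltW].
      by rewrite mulrCA divff ?gt_eqF// mulr1.
    rewrite ler_wpM2l//; first by apply: prodr_ge0 => j _; exact: powR_ge0.
    by apply: amgm_real => // j; apply: divr_ge0; [exact: fine_ge0|exact: ltW].
  rewrite EFinM cE prode_fin//= -sumEFin; congr (_ * _).
  by apply: eq_bigr => j _; rewrite -[in LHS](fineK (fF j)) -EFinM mulrAC mulrA.
apply: (@le_trans _ _ (\int[mu]_(x in D) (c * \sum_(j < m) (th j / i j)%:E * F j x))).
  apply: ge0_le_integral => //.
  apply: measurable_funeM; apply: emeasurable_sum => j.
  exact: measurable_funeM.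
have t0 j x : 0 <= (th j / i j)%:E * F j x.
  by rewrite mule_ge0// lee_fin divr_ge0// ltW.
rewrite ge0_integralZl//; last 2 first.
- apply: emeasurable_sum => j; exact: measurable_funeM.
- by move=> x _; apply: sume_ge0.
rewrite ge0_integral_sum//; last by move=> j; exact: measurable_funeM.
rewrite (_ : \sum_(j < m) _ = 1) ?mule1//.
rewrite (_ : 1 = (\sum_(j < m) th j)%:E); last by rewrite th1.
rewrite -sumEFin; apply: eq_bigr => j _; rewrite ge0_integralZl//.
  by rewrite iE -EFinM divfK ?gt_eqF.
by rewrite lee_fin divr_ge0// ltW.
Qed.

End GenericIntegral.

(** * Lebesgue measure on R^n *)

Section LebesgueIntegral.
Context {R : realType}.
Local Open Scope ereal_scope.
Local Notation mu n := (@lebesgueRn R n).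

Lemma borel_measurable_Rn n (A : set 'rV[R]_n) :
  measurable A -> measurable (A : set (Rn R n)).
Proof. exact: caratheodory_measurable_mu_ext. Qed.

Lemma borel_measurable_fun_Rn n d (U : measurableType d) (f : 'rV[R]_n -> U) :
  measurable_fun [set: 'rV[R]_n] f -> measurable_fun [set: Rn R n] f.
Proof.
move=> mf _ Y mY; rewrite setTI; apply: borel_measurable_Rn.
by rewrite -[X in measurable X]setTI; exact: mf.
Qed.

Lemma lebesgueRn_borel n (A : set 'rV[R]_n) : measurable A ->
  mu n A = borel_lebesgue n A.
Proof. by move=> mA; exact: (measurable_mu_extE (borel_lebesgue n) mA). Qed.

(** The identity, read as a measurable map from the Lebesgue to the Borel sigma-algebra, pushes the
    completed measure forward to the Borel one. *)
Lemma integral_lebesgueRn_borel n (f : 'rV[R]_n -> \bar R) :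
  measurable_fun [set: 'rV[R]_n] f -> (forall x, 0 <= f x) ->
  \int[mu n]_x f x = \int[borel_lebesgue n]_x f x.
Proof.
move=> mf f0.
pose phi : Rn R n -> 'rV[R]_n := idfun.
have mphi : measurable_fun setT phi.
  by apply: borel_measurable_fun_Rn; exact: measurable_id.
have := @ge0_integral_pushforward _ _ _ _ _ phi mphi (mu n) setT f measurableT mf.
move=> /(_ (fun x _ => f0 x)); rewrite preimage_setT => <-.
apply: eq_measure_integral => A mA _; exact: lebesgueRn_borel.
Qed.

Lemma integral_borel_lebesgueS n (f : 'rV[R]_n.+1 -> \bar R) :
  measurable_fun [set: 'rV[R]_n.+1] f -> (forall x, 0 <= f x) ->
  \int[borel_lebesgue n.+1]_x f x =
  \int[@lebesgue_measure R]_u \int[borel_lebesgue n]_z f (consRn (u, z)).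
Proof.
move=> mf f0.
have mg : measurable_fun setT (f \o @consRn R n).
  by apply: measurableT_comp => //; exact: measurable_consRn.
rewrite -(@fubini_tonelli1 _ _ _ _ _ (@lebesgue_measure R) (borel_lebesgue n) _ mg); last by move=> x; exact: f0.
have := @ge0_integral_pushforward _ _ _ _ _ _ (@measurable_consRn R n)
  (@lebesgue_measure R \x borel_lebesgue n) setT f measurableT mf.
move=> /(_ (fun x _ => f0 x)); rewrite preimage_setT => <-.
apply: eq_measure_integral => //; exact: measurable_consRn.
Qed.

Lemma measure_bigcup_eq0 n (F : nat -> set (Rn R n)) :
  (forall k, measurable (F k)) -> (forall k, mu n (F k) = 0) ->
  mu n (\bigcup_k F k) = 0.
Proof.
move=> mF F0; apply: measure_negligible; first exact: bigcupT_measurable.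
apply: negligible_bigcup => k; exists (F k); split; [exact: mF|exact: F0|by []].
Qed.

(** For finite measure, intersect Borel supersets whose measure exceeds that of the set by at most
    1/(k+1). In general, cut the set along a sigma-finite exhaustion and take the union of the
    hulls; the exceptional sets remain null. *)
Lemma borel_hull_set n (A : set (Rn R n)) : measurable A ->
  exists B : set 'rV[R]_n, [/\ measurable B, A `<=` B & mu n (B `\` A) = 0].
Proof.
have fincase (E : set (Rn R n)) : measurable E -> mu n E < +oo ->
    exists B : set 'rV[R]_n, [/\ measurable B, E `<=` B & mu n (B `\` E) = 0].
  move=> mE Efin.
  have cov (k : nat) : exists B : set 'rV[R]_n,
      [/\ measurable B, E `<=` B & mu n B <= mu n E + (k.+1%:R^-1)%:E].
    have Efn : mu n E \is a fin_num by rewrite ge0_fin_numE.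
    have /lb_ereal_inf_adherent : (0 < k.+1%:R^-1 :> R)%R by rewrite invr_gt0.
    (* [mu n E] is by construction an infimum over countable Borel covers; [F] is a cover that
       nearly attains it. *)
    move=> /(_ _ Efn)[_ [F [mF EF] <-] h].
    exists (\bigcup_i F i); split.
    - exact: bigcupT_measurable.
    - exact: EF.
    - rewrite lebesgueRn_borel; last exact: bigcupT_measurable.
      apply: le_trans (ltW h).
      by apply: measure_sigma_subadditive => //; exact: bigcupT_measurable.
  pose B k := sval (cid (cov k)).
  have Bp k : [/\ measurable (B k), E `<=` B k & mu n (B k) <= mu n E + (k.+1%:R^-1)%:E].
    exact: (svalP (cid (cov k))).
  exists (\bigcap_k B k).
  have mB : measurable (\bigcap_k B k).
    by apply: bigcapT_measurable => k; have [] := Bp k.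
  split => //.
    by move=> x Ex k _; have [_ + _] := Bp k; apply.
  rewrite measureD//=; last 2 first.
  - exact: borel_measurable_Rn.
  - apply: le_lt_trans (_ : mu n (B 0%N) < _).
      apply: le_measure; rewrite ?inE; [exact: borel_measurable_Rn| |].
        by apply: borel_measurable_Rn; have [] := Bp 0%N.
      by move=> x; exact.
    have [_ _ h] := Bp 0%N; apply: le_lt_trans h _.
    by rewrite lte_add_pinfty// ltry.
  rewrite setIidr; last by move=> x Ex k _; have [_ + _] := Bp k; apply.
  have Efn : mu n E \is a fin_num by rewrite ge0_fin_numE.
  apply/eqP; rewrite eq_le; apply/andP; split; last first.
    rewrite subre_ge0//; last first.
      rewrite ge0_fin_numE//; apply: le_lt_trans (_ : mu n (B 0%N) < _).
        apply: (@le_measure _ _ _ (mu n)); rewrite ?inE.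
        - exact: borel_measurable_Rn.
        - by apply: borel_measurable_Rn; have [] := Bp 0%N.
        - by move=> x; exact.
      have [_ _ h] := Bp 0%N; apply: le_lt_trans h _.
      by rewrite lte_add_pinfty// ltry.
    apply: (@le_measure _ _ _ (mu n)); rewrite ?inE//.
      exact: borel_measurable_Rn.
    by move=> x Ex k _; have [_ + _] := Bp k; apply.
  rewrite leeBlDr// add0e; apply/lee_addgt0Pr => e e0.
  have [k ke] : exists k, (k.+1%:R^-1 < e)%R.
    by have [k _ /(_ k (leqnn k))] := near_infty_natSinv_lt (PosNum e0); exists k.
  have [mBk _ h] := Bp k.
  apply: (@le_trans _ _ (mu n (B k))).
    apply: le_measure; rewrite ?inE; [exact: borel_measurable_Rn|exact: borel_measurable_Rn|].
    by move=> x; exact.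
  by apply: le_trans h _; rewrite leeD2l// lee_fin ltW.
move=> mA.
have /sigma_finiteP[F [TF _ Foo]] := sigma_finiteT (@borel_lebesgue R n).
have mF k : measurable (F k : set (Rn R n)).
  by apply: borel_measurable_Rn; have [] := Foo k.
have h k := fincase (A `&` F k) (measurableI _ _ mA (mF k)).
have AF k : mu n (A `&` F k) < +oo.
  apply: (@le_lt_trans _ _ (mu n (F k))).
    by apply: le_measure; rewrite ?inE//; exact: measurableI.
  by have [mFk] := Foo k; rewrite lebesgueRn_borel.
pose B k := sval (cid (h k (AF k))).
have Bp k : [/\ measurable (B k), A `&` F k `<=` B k & mu n (B k `\` (A `&` F k)) = 0].
  exact: (svalP (cid (h k (AF k)))).
exists (\bigcup_k B k).
have mB : measurable (\bigcup_k B k).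
  by apply: bigcupT_measurable => k; have [] := Bp k.
split => //.
  move=> x Ax; have [k _ Fk] : (\bigcup_k F k) x by rewrite -TF.
  by exists k => //; have [_ + _] := Bp k; apply.
pose N k := B k `\` (A `&` F k).
have mN k : measurable (N k : set (Rn R n)).
  apply: measurableD; last exact: measurableI.
  by apply: borel_measurable_Rn; have [] := Bp k.
apply: (@subset_measure0 _ _ _ (mu n) _ (\bigcup_k N k)).
- by apply: measurableD => //; exact: borel_measurable_Rn.
- exact: bigcupT_measurable.
- move=> x [[k _ Bx] nA]; exists k => //; split => // -[].
  by move/nA.
by apply: measure_bigcup_eq0 => // k; have [] := Bp k.
Qed.

(** [g] is the supremum of [q] times the indicator of a Borel hull of [q < f], over the nonnegative
    rationals [q]. Density of the rationals gives [f <= g], and [g] can exceed [f] only where some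
    hull exceeds its set, which is a null set. *)
Lemma borel_hull_fun n (f : 'rV[R]_n -> \bar R) :
  measurable_fun [set: Rn R n] f -> (forall x, 0 <= f x) ->
  exists g : 'rV[R]_n -> \bar R, [/\ measurable_fun [set: 'rV[R]_n] g,
    forall x, f x <= g x & ae_eq (mu n) [set: Rn R n] f g].
Proof.
move=> mf f0.
(* An enumeration of the nonnegative rationals; codes that decode to nothing get the level 0, which
   contributes nothing to the supremum. *)
pose q (k : nat) : R := if unpickle k is Some r then `|ratr r|%R else 0%R.
have q0 k : (0 <= q k)%R by rewrite /q; case: (unpickle k).
pose E k : set (Rn R n) := [set x | (q k)%:E < f x].
have mE k : measurable (E k).
  by rewrite -[E k]setTI; exact: emeasurable_fun_o_infty.
pose B k := sval (cid (borel_hull_set (mE k))).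
have Bp k : [/\ measurable (B k), E k `<=` B k & mu n (B k `\` E k) = 0].
  exact: (svalP (cid (borel_hull_set (mE k)))).
pose h (k : nat) (x : 'rV[R]_n) : \bar R := (q k)%:E * (\1_(B k) x)%:E.
have mh k : measurable_fun [set: 'rV[R]_n] (h k).
  apply: measurable_funeM; apply/measurable_EFinP; apply: measurable_indic.
  by have [] := Bp k.
have h0 k x : 0 <= h k x by rewrite mule_ge0// lee_fin.
pose g x := esups (h ^~ x) 0%N.
have hg k x : h k x <= g x by apply: ereal_sup_ubound; exists k.
have g0 x : 0 <= g x := le_trans (h0 0%N x) (hg 0%N x).
have fg x : f x <= g x.
  rewrite leNgt; apply/negP => gf.
  have [gx gE] : exists gx, g x = gx%:E.
    by move: gf (g0 x); case: (g x) => // [r _ _|]; [exists r|rewrite ltNge leey].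
  rewrite gE in gf.
  have [y gy yf] : exists2 y, (gx < y)%R & y%:E <= f x.
    move: gf (f0 x); case: (f x) => // [r|_ _]; first by rewrite lte_fin; exists r.
    by exists (gx + 1)%R; rewrite ?ltrDl// leey.
  have [r] := rat_in_itvoo gy; rewrite in_itv/= => /andP[gr ry].
  have r0 : (0 <= ratr r :> R)%R by rewrite (le_trans _ (ltW gr))// -lee_fin -gE.
  have := hg (pickle r) x; rewrite gE /h /q pickleK ger0_norm// indicE mem_set.
    by rewrite mule1 lee_fin leNgt gr.
  have [_ + _] := Bp (pickle r); apply; rewrite /E/= /q pickleK ger0_norm//.
  by apply: lt_le_trans yf; rewrite lte_fin.
exists g; split => //.
  exact: measurable_fun_esups.
exists (\bigcup_k (B k `\` E k)); split.
- apply: bigcupT_measurable => k; apply: measurableD => //.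
  by apply: borel_measurable_Rn; have [] := Bp k.
- apply: measure_bigcup_eq0 => k; last by have [] := Bp k.
  apply: measurableD => //.
  by apply: borel_measurable_Rn; have [] := Bp k.
- apply: subsetCl => x /= nx _; apply/eqP; rewrite eq_le fg/=.
  apply: ge_ereal_sup => _ [k _ <-]; rewrite /h indicE.
  have [xB|_] := boolP (x \in B k); last by rewrite mule0.
  rewrite mule1; have [|nE] := pselect (E k x); first exact: ltW.
  by exfalso; apply: nx; exists k => //; split => //; exact: set_mem.
Qed.

End LebesgueIntegral.

(** * From weak type to strong type *)

Section FiniteUnion.
Context {I : eqType} {T : Type}.

Definition seq_bigcup (F : I -> set T) (s : seq I) : set T :=
  \big[setU/set0]_(i <- s) F i.

Lemma seq_bigcupP (F : I -> set T) s x :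
  seq_bigcup F s x <-> exists2 i, i \in s & F i x.
Proof.
rewrite /seq_bigcup; elim: s => [|i s IH]; first by rewrite big_nil; split => // -[].
rewrite big_cons; split => [[Fi|/IH[j js Fj]]|[j]].
- by exists i; rewrite // mem_head.
- by exists j; rewrite // inE js orbT.
- by rewrite inE => /predU1P[->|js] Fj; [left|right; apply/IH; exists j].
Qed.

Lemma seq_bigcup_subset (F : I -> set T) s t :
  {subset s <= t} -> seq_bigcup F s `<=` seq_bigcup F t.
Proof. by move=> st x /seq_bigcupP[i /st it Fi]; apply/seq_bigcupP; exists i. Qed.

Lemma seq_bigcup_cons (F : I -> set T) i s :
  seq_bigcup F (i :: s) = F i `|` seq_bigcup F s.
Proof. by rewrite /seq_bigcup big_cons. Qed.

End FiniteUnion.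

Lemma measurable_seq_bigcup d (T : measurableType d) (I : eqType)
    (F : I -> set T) s :
  (forall i, i \in s -> measurable (F i)) -> measurable (seq_bigcup F s).
Proof.
elim: s => [|i s IH] mF; first by rewrite /seq_bigcup big_nil; exact: measurable0.
rewrite seq_bigcup_cons; apply: measurableU; first by apply: mF; rewrite mem_head.
by apply: IH => j js; apply: mF; rewrite inE js orbT.
Qed.

Section SeqMax.
Context {R : realType} {I : eqType}.
Local Open Scope ereal_scope.
Implicit Types (s : seq I) (F : I -> \bar R).

Lemma seq_max_ge0 s F : 0 <= \big[maxe/0]_(i <- s) F i.
Proof. exact: bigmax_ge_id. Qed.

Lemma seq_max_ge s F i : i \in s -> F i <= \big[maxe/0]_(i <- s) F i.
Proof. by move=> si; exact: (@le_bigmax_seq _ _ _ _ _ _ xpredT). Qed.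

Lemma seq_max_le s F K : 0 <= K -> (forall i, i \in s -> F i <= K) ->
  \big[maxe/0]_(i <- s) F i <= K.
Proof. by move=> K0 h; rewrite big_seq; apply: bigmax_le. Qed.

Lemma seq_max_poweR_le s F K (r : R) : (0 < r)%R -> 0 <= K ->
  (forall i, i \in s -> F i `^ r <= K) -> (\big[maxe/0]_(i <- s) F i) `^ r <= K.
Proof.
move=> r0 K0; elim: s => [|i s IH] h; first by rewrite big_nil poweR0r// gt_eqF.
rewrite big_cons; case: (leP (F i) (\big[maxe/0]_(j <- s) F j)) => _.
  by apply: IH => j js; apply: h; rewrite inE js orbT.
by apply: h; rewrite mem_head.
Qed.

Lemma measurable_seq_max d (T : measurableType d) (D : set T) s (F : I -> T -> \bar R) :
  (forall i, i \in s -> measurable_fun D (F i)) ->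
  measurable_fun D (fun x => \big[maxe/0]_(i <- s) F i x).
Proof.
elim: s => [|i s IH] mF.
  by under eq_fun do rewrite big_nil; exact: measurable_cst.
under eq_fun do rewrite big_cons.
apply: measurable_maxe; first by apply: mF; rewrite mem_head.
by apply: IH => j js; apply: mF; rewrite inE js orbT.
Qed.

End SeqMax.

Section Layers.
Context d (T : measurableType d) (R : realType).
Variable mu : {measure set T -> \bar R}.
Context {I : eqType}.
Variables (B : I -> set T) (a : I -> R) (p : R) (g : T -> R) (s0 : seq I) (K : R).
Hypothesis p1 : 1 < p.
Hypothesis mB : forall i, i \in s0 -> measurable (B i).
Hypothesis mg : measurable_fun setT g.
Hypothesis g0 : forall x, 0 <= g x.
Hypothesis K0 : 0 < K.
Hypothesis weak : forall (t : seq I) (c : R), {subset t <= s0} -> 0 <= c ->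
  (forall i, i \in t -> c <= a i) ->
  (c%:E * mu (seq_bigcup B t) <=
    K%:E * \int[mu]_x (g x * \1_[set x | (c < K * g x)%R] x)%:E)%E.

(* For [s] sorted by increasing [a], the p-th power of the maximal function
   [max {a i | i in s, x in B i}] minus [b^p], telescoped over the suffix unions,
   to which the weak type inequality applies. *)
Fixpoint layers (s : seq I) (b : R) (x : T) : R :=
  if s is i :: t then
    (a i `^ p - b `^ p) * \1_(seq_bigcup B s) x + layers t (a i) x
  else 0.

(** The part of [(K * g) ^ (p - 1)] above level [b]: an upper bound for the sum of the increments of
    [a ^ (p - 1)] over those levels from [b] upwards that lie below [K * g x]. *)
Definition excess (b : R) (x : T) : R :=
  Num.max ((K * g x) `^ (p - 1) - b `^ (p - 1)) 0.

(* Young's inequality for the product [b^(p-1) * u]. *)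
Lemma powR_diff_le (u b : R) : 0 <= b -> b <= u ->
  u `^ p - b `^ p <= p / (p - 1) * (u * (u `^ (p - 1) - b `^ (p - 1))).
Proof.
move=> b0 bu; have u0 := le_trans b0 bu.
have pp : 0 < p - 1 by rewrite subr_gt0.
have p0 : 0 < p by rewrite (lt_trans ltr01).
have q0 : 0 < p / (p - 1) by rewrite divr_gt0.
have := @conjugate_powR R (b `^ (p - 1)) u (p / (p - 1)) p (powR_ge0 _ _) u0 q0 p0.
have -> : (p / (p - 1))^-1 + p^-1 = 1.
  by rewrite invf_div mulrBl divff ?gt_eqF// mul1r subrK.
move=> /(_ erefl); rewrite -powRrM mulrCA divff ?gt_eqF// mulr1 => h.
have uE : u * u `^ (p - 1) = u `^ p.
  have [->|un0] := eqVneq u 0; first by rewrite mul0r powR0// gt_eqF.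
  rewrite -[X in X * _](powRr1 u0) -powRD; last by rewrite un0 implybT.
  by rewrite addrC subrK.
rewrite mulrBr uE.
have := ler_wpM2l (ltW q0) h.
rewrite mulrDr => {}h.
have e' : p / (p - 1) * (b `^ p / (p / (p - 1))) = b `^ p.
  by field; rewrite !gt_eqF.
have e : p / (p - 1) * (u `^ p / p) = p / (p - 1) * u `^ p - u `^ p.
  by field; rewrite !gt_eqF.
rewrite e e' (mulrC (b `^ _)) in h.
by rewrite mulrBr; lra.
Qed.

Lemma measurable_layers s b : {subset s <= s0} -> measurable_fun setT (layers s b).
Proof.
elim: s b => [|i t IH] b st /=; first exact: measurable_cst.
apply: measurable_funD; last by apply: IH => j jt; apply: st; rewrite inE jt orbT.
apply: measurable_funM => //; apply: measurable_indic.
by apply: measurable_seq_bigcup => j /st; exact: mB.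
Qed.

Lemma layers_ge0 s (b : R) x : 0 <= b -> path <=%O b (map a s) -> 0 <= layers s b x.
Proof.
elim: s b => [//|i t IH] b b0 /= /andP[ba pt].
rewrite addr_ge0//; last by apply: IH => //; exact: le_trans ba.
rewrite mulr_ge0// subr_ge0 ge0_ler_powR ?nnegrE//.
- by rewrite (le_trans ler01)// ltW.
- exact: le_trans ba.
Qed.

(** All suffixes down to the one starting with [i] have [x] in their union, so the increments up to
    [a i] are all counted and telescope; the later layers are nonnegative. *)
Lemma le_layers s (b : R) x i : 0 <= b -> path <=%O b (map a s) -> i \in s -> B i x ->
  a i `^ p - b `^ p <= layers s b x.
Proof.
elim: s b => [//|j t IH] b b0 /= /andP[ba pt] + Bx.
have aj0 : 0 <= a j := le_trans b0 ba.
rewrite inE => /predU1P[ij|it].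
  rewrite indicE mem_set; last by apply/seq_bigcupP; exists j; rewrite ?mem_head// -ij.
  by rewrite mulr1 ij lerDl layers_ge0.
rewrite indicE mem_set; last by apply/seq_bigcupP; exists i; rewrite // inE it orbT.
by rewrite mulr1; have := IH _ aj0 pt it Bx; lra.
Qed.

Lemma excess_ge0 b x : 0 <= excess b x.
Proof. by rewrite le_max lexx orbT. Qed.

Lemma measurable_excess b : measurable_fun setT (excess b).
Proof.
apply: measurable_maxr; last exact: measurable_cst.
apply: measurable_funB; last exact: measurable_cst.
apply: (@measurableT_comp _ _ _ _ _ _ (@powR R ^~ (p - 1))) => //.
exact: measurable_funM.
Qed.

(** Where [u < K * g x] the increments telescope to an equality; elsewhere the left-hand side is
    zero. *)
Lemma excess_step (b u : R) x : 0 <= b -> b <= u ->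
  (u `^ (p - 1) - b `^ (p - 1)) * \1_[set x | u < K * g x] x + excess u x
    <= excess b x.
Proof.
move=> b0 bu; rewrite /excess indicE.
have pp : 0 <= p - 1 by rewrite subr_ge0 ltW.
have pbu : b `^ (p - 1) <= u `^ (p - 1).
  by rewrite ge0_ler_powR ?nnegrE// (le_trans b0).
have [h|h] := ltP u (K * g x).
  rewrite mem_set// mulr1.
  have pug : u `^ (p - 1) <= (K * g x) `^ (p - 1).
    by rewrite ge0_ler_powR ?nnegrE ?(ltW h)// (le_trans b0 bu, mulr_ge0 (ltW K0) (g0 x)).
  by rewrite !max_l; lra.
rewrite memNset/=; last by apply/negP; rewrite -leNgt.
rewrite mulr0 add0r.
have pug : (K * g x) `^ (p - 1) <= u `^ (p - 1).
  by rewrite ge0_ler_powR ?nnegrE// (le_trans b0 bu, mulr_ge0 (ltW K0) (g0 x)).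
by rewrite max_r ?le_max ?lexx ?orbT// subr_le0.
Qed.

(** The layer-cake proof of Marcinkiewicz interpolation, with a sum over the finitely many values of
    [a] in place of the integral over levels. [powR_diff_le] turns an increment of [a ^ p] into [a]
    times an increment of [a ^ (p - 1)]; the weak type inequality absorbs this factor [a] with the
    measure of the union, and [excess_step] resums. *)
Lemma integral_layers s (b : R) : {subset s <= s0} -> 0 <= b ->
  path <=%O b (map a s) ->
  (\int[mu]_x (layers s b x)%:E <=
    (K * (p / (p - 1)))%:E * \int[mu]_x (g x * excess b x)%:E)%E.
Proof.
have q0 : 0 <= p / (p - 1).
  by rewrite divr_ge0 ?subr_ge0// ltW// (lt_trans ltr01).
elim: s b => [|i t IH] b ss b0 /=.
  move=> _; rewrite integral0; apply: mule_ge0.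
    by rewrite lee_fin mulr_ge0// ltW.
  by apply: integral_ge0 => x _; rewrite lee_fin mulr_ge0// excess_ge0.
move=> /andP[ba pt].
have ts : {subset t <= s0} by move=> j jt; apply: ss; rewrite inE jt orbT.
have a0 : 0 <= a i := le_trans b0 ba.
have mU : measurable (seq_bigcup B (i :: t)).
  by apply: measurable_seq_bigcup => j /ss; exact: mB.
have d0 : 0 <= a i `^ p - b `^ p.
  by rewrite subr_ge0 ge0_ler_powR ?nnegrE// (le_trans ler01)// ltW.
have e0 : 0 <= a i `^ (p - 1) - b `^ (p - 1).
  by rewrite subr_ge0 ge0_ler_powR ?nnegrE// subr_ge0 ltW.
have mI : measurable_fun setT (\1_[set x | (a i < K * g x)%R] : T -> R).
  apply: measurable_indic; rewrite -[X in measurable X]setTI.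
  apply: (@measurable_fun_ltr _ _ R setT (cst (a i)) (fun x => K * g x) (measurable_cst _)) => //.
  exact: measurable_funM.
rewrite (eq_integral (fun x => ((a i `^ p - b `^ p) * \1_(seq_bigcup B (i :: t)) x)%:E
    + (layers t (a i) x)%:E)%E); last by move=> x _; rewrite -EFinD.
rewrite ge0_integralD//; last 4 first.
- by move=> x _; rewrite lee_fin mulr_ge0.
- by apply/measurable_EFinP; apply: measurable_funM => //; exact: measurable_indic.
- by move=> x _; rewrite lee_fin layers_ge0.
- by apply/measurable_EFinP; exact: measurable_layers.
under eq_integral do rewrite EFinM.
rewrite ge0_integralZl ?lee_fin//; last first.
  by apply/measurable_EFinP; exact: measurable_indic.
rewrite integral_indic// setIT.
have W : ((a i)%:E * mu (seq_bigcup B (i :: t)) <=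
    K%:E * \int[mu]_x (g x * \1_[set x | (a i < K * g x)%R] x)%:E)%E.
  apply: weak => // j; rewrite inE => /predU1P[->//|jt].
  have /allP := order_path_min le_trans pt; apply.
  exact: map_f.
set J := (\int[mu]_x (g x * \1_[set x | (a i < K * g x)%R] x)%:E)%E in W.
have J0 : (0 <= J)%E.
  by apply: integral_ge0 => x _; rewrite lee_fin mulr_ge0.
apply: (@le_trans _ _ ((K * (p / (p - 1)) * (a i `^ (p - 1) - b `^ (p - 1)))%:E * J +
   (K * (p / (p - 1)))%:E * \int[mu]_x (g x * excess (a i) x)%:E)%E).
  apply: leeD; last exact: IH.
  apply: (@le_trans _ _ ((p / (p - 1) * (a i * (a i `^ (p - 1) - b `^ (p - 1))))%:E
      * mu (seq_bigcup B (i :: t)))%E).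
    by rewrite lee_wpmul2r// lee_fin powR_diff_le.
  have -> : p / (p - 1) * (a i * (a i `^ (p - 1) - b `^ (p - 1))) =
     p / (p - 1) * (a i `^ (p - 1) - b `^ (p - 1)) * a i by ring.
  rewrite EFinM -muleA.
  have -> : K * (p / (p - 1)) * (a i `^ (p - 1) - b `^ (p - 1)) =
     p / (p - 1) * (a i `^ (p - 1) - b `^ (p - 1)) * K by ring.
  by rewrite [in leRHS]EFinM -[leRHS]muleA lee_wpmul2l// lee_fin mulr_ge0.
rewrite EFinM -muleA -ge0_muleDr; last 2 first.
- by rewrite mule_ge0// lee_fin.
- by apply: integral_ge0 => x _; rewrite lee_fin mulr_ge0// excess_ge0.
apply: lee_wpmul2l; first by rewrite lee_fin mulr_ge0// ltW.
rewrite /J -ge0_integralZl ?lee_fin//; last 2 first.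
- by apply/measurable_EFinP; exact: measurable_funM.
- by move=> x _; rewrite lee_fin mulr_ge0.
rewrite -ge0_integralD//; last 4 first.
- by move=> x _; rewrite mule_ge0 ?lee_fin// mulr_ge0.
- apply: measurable_funeM; apply/measurable_EFinP; exact: measurable_funM.
- by move=> x _; rewrite lee_fin mulr_ge0// excess_ge0.
- by apply/measurable_EFinP; apply: measurable_funM => //; exact: measurable_excess.
apply: ge0_le_integral => //.
- move=> x _; rewrite adde_ge0//; first by rewrite mule_ge0 ?lee_fin// mulr_ge0.
  by rewrite lee_fin mulr_ge0// excess_ge0.
- apply: emeasurable_funD.
    apply: measurable_funeM; apply/measurable_EFinP; exact: measurable_funM.
  by apply/measurable_EFinP; apply: measurable_funM => //; exact: measurable_excess.
- by apply/measurable_EFinP; apply: measurable_funM => //; exact: measurable_excess.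
- move=> x _; rewrite -EFinM -EFinD lee_fin mulrCA -mulrDr ler_wpM2l//.
  exact: excess_step.
Qed.

End Layers.

(** * The maximal theorem on the line for finitely many intervals *)

Section IntervalMaximal.
Context {R : realType}.
Local Notation leb := (@lebesgue_measure R).
Local Open Scope ereal_scope.

Definition open_itv (r : R * R) : set R := [set` `]r.1, r.2[%R].

Definition itv_average (f : R -> \bar R) (r : R * R) : \bar R :=
  ((r.2 - r.1)^-1)%:E * \int[leb]_(x in open_itv r) f x.

Lemma open_itv_ball (r : R * R) :
  open_itv r = ball ((r.1 + r.2) / 2)%R ((r.2 - r.1) / 2)%R.
Proof.
rewrite ball_itv /open_itv.
have -> : ((r.1 + r.2) / 2 - (r.2 - r.1) / 2 = r.1)%R by lra.
by have -> : ((r.1 + r.2) / 2 + (r.2 - r.1) / 2 = r.2)%R by lra.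
Qed.

Lemma measurable_open_itv r : measurable (open_itv r : set (measurableTypeR R)).
Proof. exact: measurable_itv. Qed.

Lemma lebesgue_open_itv r : (r.1 < r.2)%R -> leb (open_itv r) = (r.2 - r.1)%:E.
Proof.
by move=> h; rewrite /open_itv lebesgue_measure_itv/= lte_fin h EFinB.
Qed.

Lemma vitali_weak_type (g : R -> \bar R) (s : seq (R * R)) (c : R) :
  measurable_fun [set: measurableTypeR R] g -> (forall x, 0 <= g x) ->
  (forall r, r \in s -> (r.1 < r.2)%R) -> (0 <= c)%R ->
  (forall r, r \in s -> c%:E * leb (open_itv r) <= \int[leb]_(x in open_itv r) g x) ->
  c%:E * leb (seq_bigcup open_itv s) <= 3%:E * \int[leb]_(x in seq_bigcup open_itv s) g x.
Proof.
move=> mg g0 s12 c0 hc.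
(* Vitali's lemma wants nonempty balls at every index, also outside [s]. *)
pose B (r : R * R) := if (r.1 < r.2)%R then open_itv r else ball r.1 1%R.
have BE r : r \in s -> B r = open_itv r by move=> /s12 h; rewrite /B h.
have bB r : is_ball (B r).
  by rewrite /B; case: ifP => _; rewrite ?open_itv_ball; exact: is_ball_ball.
have nB r : B r !=set0.
  rewrite /B; case: ifP => h; last by exists r.1; exact: ballxx.
  by exists ((r.1 + r.2) / 2)%R; rewrite open_itv_ball; apply: ballxx; lra.
have mB r : measurable (B r : set (measurableTypeR R)).
  by rewrite /B; case: ifP => _; [exact: measurable_open_itv|exact: measurable_ball].
have [D [uD Ds tD sD]] := vitali_lemma_finite_cover bB nB s.
have m3 r : measurable (3%:R *` B r : set (measurableTypeR R)).
  by rewrite (ballE (bB r)) scale_ballE//; exact: measurable_ball.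
have mU t : (forall r, r \in t -> r \in s) ->
    measurable (seq_bigcup open_itv t : set (measurableTypeR R)).
  by move=> _; apply: measurable_seq_bigcup => r _; exact: measurable_open_itv.
apply: (@le_trans _ _ (c%:E * \sum_(r <- D) leb (3%:R *` B r))).
  rewrite lee_wpmul2l//.
  apply: (@le_trans _ _ (leb (seq_bigcup (fun r => 3%:R *` B r) D))).
    apply: le_measure; rewrite ?inE.
    - exact: mU.
    - by apply: measurable_seq_bigcup => r _; exact: m3.
    move=> x /seq_bigcupP[r rs rx]; apply/seq_bigcupP.
    have [|i iD ix] := sD x; first by exists r; rewrite //= BE.
    by exists i.
  rewrite /seq_bigcup; elim: (D) => [|r t IH]; first by rewrite !big_nil measure0.
  rewrite !big_cons; apply: le_trans (leeD2l _ IH).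
  apply: measureU2; first exact: m3.
  by apply: (@measurable_seq_bigcup _ _ _ (fun r => 3%:R *` B r)) => i _; exact: m3.
rewrite (_ : \sum_(r <- D) leb (3%:R *` B r) = 3%:E * \sum_(r <- D) leb (open_itv r)); last first.
  rewrite ge0_sume_distrr//= big_seq [RHS]big_seq; apply: eq_bigr => r rD.
  have rs := Ds _ rD; have h := s12 _ rs.
  rewrite BE// open_itv_ball scale_ballE// !lebesgue_measure_ball; [|lra|lra].
  by rewrite -EFinM; congr EFin; rewrite mulrnAr.
rewrite muleCA lee_wpmul2l// ge0_sume_distrr//.
apply: (@le_trans _ _ (\sum_(r <- D) \int[leb]_(x in B r) g x)).
  rewrite big_seq [leRHS]big_seq; apply: lee_sum => r /Ds rs; rewrite BE//.
  exact: hc.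
rewrite -ge0_integral_bigsetU//=.
- apply: ge0_subset_integral => //.
  + by apply: bigsetU_measurable => r _; exact: mB.
  + exact: mU.
  + exact: measurable_funTS.
  + move=> x /(@seq_bigcupP _ _ B) [r /Ds rs rx]; apply/seq_bigcupP; exists r => //.
    by rewrite -BE.
- exact: measurable_funTS.
Qed.

(** Where [6 * g <= c], the function contributes at most [c / 6] times the measure of the union.
    Vitali's factor 3 makes this half of the left-hand side, which can be absorbed because the union
    has finite measure; this doubles 3 to 6. *)
Lemma vitali_weak_type_truncated (g : R -> R) (s : seq (R * R)) (c : R) :
  measurable_fun [set: measurableTypeR R] g -> (forall x, (0 <= g x)%R) ->
  (forall r, r \in s -> (r.1 < r.2)%R) -> (0 <= c)%R ->
  (forall r, r \in s -> c%:E * leb (open_itv r) <= \int[leb]_(x in open_itv r) (g x)%:E) ->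
  c%:E * leb (seq_bigcup open_itv s) <=
   6%:E * \int[leb]_x (g x * \1_[set x | (c < 6 * g x)%R] x)%:E.
Proof.
move=> mg g0 s12 c0 hc.
set U := seq_bigcup open_itv s.
have mU : measurable (U : set (measurableTypeR R)).
  by apply: measurable_seq_bigcup => r _; exact: measurable_open_itv.
have Ufin : leb U < +oo.
  rewrite /U; elim: (s) => [|r t IH]; first by rewrite /seq_bigcup big_nil measure0.
  rewrite seq_bigcup_cons; apply: le_lt_trans (measureU2 _ _ _) _.
  - exact: measurable_open_itv.
  - by apply: measurable_seq_bigcup => i _; exact: measurable_open_itv.
  have h : leb (open_itv r) < +oo.
    rewrite /open_itv lebesgue_measure_itv/=.
    by case: ifP; rewrite ?ltry// -EFinB ltry.
  exact: lte_add_pinfty.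
have mI : measurable_fun [set: measurableTypeR R] (\1_[set x | (c < 6 * g x)%R] : R -> R).
  apply: measurable_indic; rewrite -[X in measurable X]setTI.
  apply: (@measurable_fun_ltr _ _ R setT (cst c) (fun x => 6 * g x)%R (measurable_cst _)) => //.
  exact: measurable_funM.
set J := \int[leb]_x (g x * \1_[set x | (c < 6 * g x)%R] x)%:E.
have mgI : measurable_fun [set: measurableTypeR R] (fun x => (g x * \1_[set x | (c < 6 * g x)%R] x)%:E).
  by apply/measurable_EFinP; exact: measurable_funM.
have J0 : 0 <= J by apply: integral_ge0 => x _; rewrite lee_fin mulr_ge0.
have W := @vitali_weak_type (EFin \o g) s c.
have {}W : c%:E * leb U <= 3%:E * \int[leb]_(x in U) (g x)%:E.
  by apply: W => //; exact/measurable_EFinP.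
have h1 : \int[leb]_(x in U) (g x)%:E <= J + (c / 6)%:E * leb U.
  apply: (@le_trans _ _ (\int[leb]_(x in U) ((g x * \1_[set x | (c < 6 * g x)%R] x)%:E + (c / 6)%:E))).
    apply: ge0_le_integral => //.
    - by move=> x _; rewrite lee_fin.
    - by apply: measurable_funTS; exact/measurable_EFinP.
    - by apply: emeasurable_funD; [exact: measurable_funTS|exact: measurable_cst].
    - move=> x _; rewrite -EFinD lee_fin indicE.
      have [h|h] := ltP c (6 * g x)%R.
        by rewrite mem_set// mulr1 lerDl; lra.
      rewrite memNset/=; last by apply/negP; rewrite -leNgt.
      by rewrite mulr0 add0r; lra.
  rewrite (ge0_integralD leb mU); last 4 first.
  - by move=> x _; rewrite lee_fin mulr_ge0.
  - exact: measurable_funTS.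
  - by move=> x _; rewrite lee_fin; lra.
  - exact: measurable_cst.
  rewrite integral_cst// leeD2r//; apply: ge0_subset_integral => //.
  by move=> x _; rewrite lee_fin mulr_ge0.
have Uf : leb U \is a fin_num by rewrite ge0_fin_numE.
have [->|Jy] := eqVneq J +oo; first by rewrite gt0_muley ?leey.
have Jf : J \is a fin_num by rewrite ge0_fin_numE// lt_neqAle Jy leey.
have [u uE] : exists u, leb U = u%:E by exists (fine (leb U)); rewrite fineK.
have [j jE] : exists j, J = j%:E by exists (fine J); rewrite fineK.
have h30 : 0 <= 3%:E :> \bar R by rewrite lee_fin.
have {h1}W := le_trans W (lee_wpmul2l h30 h1).
move: W; rewrite uE jE -!EFinM !lee_fin.
lra.
Qed.

(** [integral_layers] with [K = 6], for the intervals sorted by their averages. At level 0 the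
    excess is [(6 * g) ^ (p - 1)], the source of the last factor of the constant. *)
Lemma interval_maximal_real (p : R) (g : R -> R) (s : seq (R * R)) : (1 < p)%R ->
  measurable_fun [set: measurableTypeR R] g -> (forall x, (0 <= g x)%R) ->
  (forall r, r \in s -> (r.1 < r.2)%R) ->
  (forall r, r \in s -> itv_average (EFin \o g) r < +oo) ->
  \int[leb]_x (\big[maxe/0]_(r <- s) ((\1_(open_itv r) x)%:E * itv_average (EFin \o g) r)) `^ p
  <= (6 * (p / (p - 1)) * 6 `^ (p - 1))%:E * \int[leb]_x (g x `^ p)%:E.
Proof.
move=> p1 mg g0 s12 afin.
have p0 : (0 < p)%R by rewrite (lt_trans ltr01).
have pp : (0 < p - 1)%R by rewrite subr_gt0.
have a0 r : r \in s -> 0 <= itv_average (EFin \o g) r.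
  move=> rs; apply: mule_ge0; first by rewrite lee_fin invr_ge0 subr_ge0 ltW ?s12.
  by apply: integral_ge0 => x _; rewrite lee_fin.
pose a r := fine (itv_average (EFin \o g) r).
have aE r : r \in s -> itv_average (EFin \o g) r = (a r)%:E.
  by move=> rs; rewrite fineK// ge0_fin_numE ?a0 ?afin.
pose s' := sort (fun r q => (a r <= a q)%R) s.
have ms r : (r \in s') = (r \in s) by rewrite mem_sort.
have pth : path <=%O 0%R (map a s').
  have : sorted (fun r q => (a r <= a q)%R) s' by apply: sort_sorted => r q; exact: le_total.
  have : forall r, r \in s' -> (0 <= a r)%R.
    by move=> r; rewrite ms => rs; rewrite fine_ge0 ?a0.
  case: (s') => //= r t h; rewrite h ?mem_head//=.
  by rewrite path_map.
have weak t c : {subset t <= s} -> (0 <= c)%R -> (forall i, i \in t -> (c <= a i)%R) ->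
  c%:E * leb (seq_bigcup open_itv t) <=
    6%:E * \int[leb]_x (g x * \1_[set x | (c < 6 * g x)%R] x)%:E.
  move=> ts c0 ca; apply: vitali_weak_type_truncated => //; first by move=> r /ts /s12.
  move=> r rt; have rs := ts _ rt; have h := s12 _ rs.
  rewrite lebesgue_open_itv//.
  have : c%:E <= itv_average (EFin \o g) r by rewrite aE// lee_fin ca.
  by rewrite /itv_average lee_pdivlMl ?subr_gt0// muleC.
have mo r : r \in s -> measurable (open_itv r : set (measurableTypeR R)).
  by move=> _; exact: measurable_open_itv.
have ss : {subset s' <= s} by move=> r; rewrite ms.
have := @integral_layers _ _ R leb _ open_itv a p g s 6%R p1 mo mg g0 _ weak s' 0%R ss (lexx _) pth.
move=> /(_ (ltr0n _ _)) L.
apply: (@le_trans _ _ (\int[leb]_x (layers open_itv a p s' 0 x)%:E)).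
  apply: ge0_le_integral => //.
  - by move=> x _; exact: poweR_ge0.
  - apply: emeasurable_powR; apply: measurable_seq_max => r rs.
    rewrite aE//; apply: emeasurable_funM; last exact: measurable_cst.
    apply/measurable_EFinP; apply: measurable_indic.
    exact: measurable_open_itv.
  - by apply/measurable_EFinP; apply: measurable_layers; [exact: mo|exact: ss].
  - move=> x _; apply: seq_max_poweR_le => //; first by rewrite lee_fin layers_ge0.
    move=> r rs; rewrite indicE; have [xr|xr] := boolP (x \in open_itv r); last first.
      by rewrite mul0e poweR0r ?gt_eqF// lee_fin layers_ge0.
    rewrite mul1e aE// poweR_EFin lee_fin.
    have -> : (a r `^ p = a r `^ p - 0 `^ p)%R by rewrite powR0 ?gt_eqF// subr0.
    apply: le_layers => //; first by rewrite ms.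
    exact: set_mem.
apply: (le_trans L).
rewrite [in leRHS]EFinM -[leRHS]muleA lee_wpmul2l//.
  by rewrite lee_fin mulr_ge0// divr_ge0 ?(ltW p0) ?(ltW pp).
rewrite -ge0_integralZl ?lee_fin ?powR_ge0//; last 2 first.
- apply/measurable_EFinP; apply: (@measurableT_comp _ _ _ _ _ _ (@powR R ^~ p)) => //.
- by move=> x _; rewrite lee_fin powR_ge0.
apply: ge0_le_integral => //.
- by move=> x _; rewrite lee_fin mulr_ge0// (excess_ge0 p g 6).
- by apply/measurable_EFinP; apply: measurable_funM => //; exact: measurable_excess.
- apply: measurable_funeM; apply/measurable_EFinP.
  exact: (@measurableT_comp _ _ _ _ _ _ (@powR R ^~ p)).
- move=> x _; rewrite -EFinM lee_fin /excess powR0 ?gt_eqF// subr0 max_l ?powR_ge0//.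
  rewrite powRM// mulrCA ler_wpM2l ?powR_ge0//.
  have [->|gn0] := eqVneq (g x) 0%R; first by rewrite mul0r powR_ge0.
  rewrite -[X in (X * _)%R](powRr1 (g0 x)) -powRD; last by rewrite gn0 implybT.
  by rewrite addrC subrK.
Qed.

(** If the right-hand integral is infinite there is nothing to prove; otherwise [f] is finite almost
    everywhere, and the real function [fine (f x)] has the same averages. *)
Lemma interval_maximal (p : R) (f : R -> \bar R) (s : seq (R * R)) : (1 < p)%R ->
  measurable_fun [set: measurableTypeR R] f -> (forall x, 0 <= f x) ->
  (forall r, r \in s -> (r.1 < r.2)%R) ->
  \int[leb]_x (\big[maxe/0]_(r <- s) ((\1_(open_itv r) x)%:E * itv_average f r)) `^ p
  <= (6 * (p / (p - 1)) * 6 `^ (p - 1))%:E * \int[leb]_x (f x `^ p).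
Proof.
move=> p1 mf f0 s12.
have p0 : (0 < p)%R by rewrite (lt_trans ltr01).
have pp : (0 < p - 1)%R by rewrite subr_gt0.
have C0 : (0 < 6 * (p / (p - 1)) * 6 `^ (p - 1))%R.
  by rewrite mulr_gt0 ?powR_gt0// mulr_gt0// divr_gt0.
have mfp : measurable_fun [set: measurableTypeR R] (fun x => f x `^ p).
  exact: emeasurable_powR.
have [->|fy] := eqVneq (\int[leb]_x (f x `^ p)) +oo.
  by rewrite gt0_muley ?leey// lte_fin.
have ffin : \int[leb]_x (f x `^ p) < +oo by rewrite lt_neqAle fy leey.
have ifp : leb.-integrable setT (fun x => f x `^ p).
  apply/integrableP; split => //.
  by under eq_integral do rewrite gee0_abs ?poweR_ge0//.
have aefin := integrable_ae measurableT ifp.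
pose g x := fine (f x).
have mg : measurable_fun [set: measurableTypeR R] g.
  exact: (measurableT_comp (fine_measurable measurableT)).
have g0 x : (0 <= g x)%R by rewrite fine_ge0.
have fg : ae_eq leb setT f (EFin \o g).
  apply: filterS aefin => x /= h _; rewrite /g/= fineK//.
  have := h I; rewrite !ge0_fin_numE ?poweR_ge0// => h'.
  by apply: lty_poweRy h'; rewrite gt_eqF.
have mEg : measurable_fun [set: measurableTypeR R] (EFin \o g) by exact/measurable_EFinP.
have avE r : itv_average f r = itv_average (EFin \o g) r.
  congr (_ * _); apply: ge0_ae_eq_integral => //.
  - exact: measurable_open_itv.
  - exact: measurable_funTS.
  - exact: measurable_funTS.
  - by move=> x _; rewrite lee_fin.
  - by apply: filterS fg => x /= h _; exact: h.
under eq_integral do under eq_bigr do rewrite avE.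
have -> : \int[leb]_x (f x `^ p) = \int[leb]_x (g x `^ p)%:E.
  apply: ge0_ae_eq_integral => //.
  - apply/measurable_EFinP; exact: (@measurableT_comp _ _ _ _ _ _ (@powR R ^~ p)).
  - by move=> x _; exact: poweR_ge0.
  - by move=> x _; rewrite lee_fin powR_ge0.
  - by apply: filterS fg => x /= h _; rewrite h.
apply: interval_maximal_real => // r rs.
rewrite -avE lte_mul_pinfty// ?lee_fin ?invr_ge0 ?subr_ge0 ?(ltW (s12 _ rs))//.
(* The averages are finite since [f <= 1 + f ^ p] and the interval has finite length. *)
apply: (@le_lt_trans _ _ (\int[leb]_(x in open_itv r) (1 + f x `^ p))).
  apply: ge0_le_integral => //.
  - exact: measurable_open_itv.
  - exact: measurable_funTS.
  - by apply: emeasurable_funD; [exact: measurable_cst|exact: measurable_funTS].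
  - move=> x _; have [h|h] := leP (f x) 1.
      by apply: (le_trans h); rewrite leeDl// poweR_ge0.
    apply: (@le_trans _ _ (f x `^ p)); last by rewrite leeDr.
    rewrite -[leLHS]poweRe1//.
    move: h; case: (f x) => // [y|_]; last by rewrite !poweRyr ?gt_eqF.
    rewrite lte_fin !poweR_EFin lee_fin => y1.
    by rewrite ler_powR// ltW.
rewrite (ge0_integralD leb (measurable_open_itv r)); last 4 first.
- by [].
- exact: measurable_cst.
- by move=> x _; exact: poweR_ge0.
- exact: measurable_funTS.
rewrite integral_cst; last exact: measurable_open_itv.
have h : leb (open_itv r) < +oo by rewrite lebesgue_open_itv ?s12// ltry.
rewrite mul1e; apply: lte_add_pinfty; first exact: h.
apply: le_lt_trans ffin.
exact: (@ge0_subset_integral _ (measurableTypeR R) R leb (open_itv r) setT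
  (measurable_open_itv r) measurableT (fun x => f x `^ p) mfp
  (fun x _ => poweR_ge0 _ _) (@subsetT _ _)).
Qed.

End IntervalMaximal.

(** * The strong maximal theorem *)

Lemma integral_indicM d (T : measurableType d) (R : realType)
    (mu : {measure set T -> \bar R}) (D : set T) (f : T -> \bar R) :
  (\int[mu]_(x in D) f x = \int[mu]_x ((\1_D x)%:E * f x))%E.
Proof.
rewrite integral_mkcond; apply: eq_integral => x _.
by rewrite patchE indicE; case: ifP => _; rewrite ?mul1e ?mul0e.
Qed.

Section RectangleMaximal.
Context {R : realType}.
Local Notation leb := (@lebesgue_measure R).
Local Open Scope ereal_scope.

Definition rect n (r : 'rV[R]_n * 'rV[R]_n) : set 'rV[R]_n := rectangle r.1 r.2.

Definition proper_rect n (r : 'rV[R]_n * 'rV[R]_n) :=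
  forall i, (r.1 ord0 i < r.2 ord0 i)%R.

Definition rect_volume n (r : 'rV[R]_n * 'rV[R]_n) : R :=
  \prod_i (r.2 ord0 i - r.1 ord0 i)%R.

Lemma rect_volume_gt0 n (r : 'rV[R]_n * 'rV[R]_n) :
  proper_rect r -> (0 < rect_volume r)%R.
Proof. by move=> h; apply: prodr_gt0 => i _; rewrite subr_gt0. Qed.

Lemma measurable_rect n (r : 'rV[R]_n * 'rV[R]_n) :
  proper_rect r -> measurable (rect r).
Proof. by move=> h; have [] := borel_lebesgue_rectangle (fun i => ltW (h i)). Qed.

Definition borel_average n (f : 'rV[R]_n -> \bar R) (r : 'rV[R]_n * 'rV[R]_n) : \bar R :=
  ((rect_volume r)^-1)%:E * \int[borel_lebesgue n]_(x in rect r) f x.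

Definition tail_row n (x : 'rV[R]_n.+1) : 'rV[R]_n := \row_j x ord0 (lift ord0 j).

Definition head_itv n (r : 'rV[R]_n.+1 * 'rV[R]_n.+1) : R * R :=
  (r.1 ord0 ord0, r.2 ord0 ord0).

Definition tail_rect n (r : 'rV[R]_n.+1 * 'rV[R]_n.+1) :=
  (tail_row r.1, tail_row r.2).

Lemma proper_tail_rect n (r : 'rV[R]_n.+1 * 'rV[R]_n.+1) :
  proper_rect r -> proper_rect (tail_rect r).
Proof. by move=> h i; rewrite !mxE. Qed.

Lemma rect_volumeS n (r : 'rV[R]_n.+1 * 'rV[R]_n.+1) :
  rect_volume r = (((head_itv r).2 - (head_itv r).1) * rect_volume (tail_rect r))%R.
Proof.
by rewrite /rect_volume big_ord_recl; congr (_ * _)%R; apply: eq_bigr => i _; rewrite !mxE.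
Qed.

Lemma rect_consRn n (r : 'rV[R]_n.+1 * 'rV[R]_n.+1) (u : R) z :
  rect r (consRn (u, z)) <-> open_itv (head_itv r) u /\ rect (tail_rect r) z.
Proof.
rewrite /open_itv /rect /rectangle/= in_itv/=; split => [h|[h0 h] i].
  split; first by have := h ord0; have := consRn0 (u, z); rewrite /coordRn => ->.
  move=> i; rewrite !mxE; have := h (lift ord0 i).
  by have := consRn_lift (u, z) i; rewrite /coordRn => ->.
case: (unliftP ord0 i) => [j ->|->].
  by move: (h j); have := consRn_lift (u, z) j; rewrite /coordRn => ->; rewrite !mxE.
by have := consRn0 (u, z); rewrite /coordRn => ->.
Qed.

Lemma indic_rect_consRn n (r : 'rV[R]_n.+1 * 'rV[R]_n.+1) (u : R) z :
  (\1_(rect r) (consRn (u, z)) = \1_(open_itv (head_itv r)) u * \1_(rect (tail_rect r)) z :> R)%R.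
Proof.
rewrite !indicE -natrM mulnb; congr ((nat_of_bool _)%:R); apply/idP/andP => /=.
  by rewrite !inE => /rect_consRn.
by rewrite !inE => -[? ?]; apply/rect_consRn.
Qed.

Lemma measurable_indicE d (T : measurableType d) (A : set T) :
  measurable A -> measurable_fun setT (fun x => (\1_A x : R)%:E).
Proof. by move=> mA; apply/measurable_EFinP; exact: measurable_indic. Qed.

Lemma borel_average_ge0 n (f : 'rV[R]_n -> \bar R) r :
  (forall x, 0 <= f x) -> proper_rect r -> 0 <= borel_average f r.
Proof.
move=> f0 h; apply: mule_ge0; first by rewrite lee_fin invr_ge0 ltW// rect_volume_gt0.
exact: integral_ge0.
Qed.

Section slices.
Variables (n : nat) (f : 'rV[R]_n.+1 -> \bar R).
Hypothesis mf : measurable_fun [set: 'rV[R]_n.+1] f.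
Hypothesis f0 : forall x, 0 <= f x.

Let F (w : measurableTypeR R * 'rV[R]_n) : \bar R := f (consRn w).

Let mF : measurable_fun setT F.
Proof. by apply: measurableT_comp => //; exact: measurable_consRn. Qed.

Lemma measurable_slice u : measurable_fun [set: 'rV[R]_n] (fun z => f (consRn (u, z))).
Proof. exact: (measurableT_comp mF). Qed.

Lemma measurable_slice_average (r : 'rV[R]_n * 'rV[R]_n) : proper_rect r ->
  measurable_fun [set: measurableTypeR R]
    (fun u => borel_average (fun z => f (consRn (u, z))) r).
Proof.
move=> hr; apply: measurable_funeM.
under eq_fun do rewrite integral_indicM.
apply: (@measurable_fun_fubini_tonelli_F _ _ (measurableTypeR R) 'rV[R]_n R
  (borel_lebesgue n) (fun w => (\1_(rect r) w.2)%:E * F w)).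
- apply: emeasurable_funM => //.
  apply: (@measurableT_comp _ _ _ _ _ _ (fun z => (\1_(rect r) z)%:E) _ snd) => //.
  exact: measurable_indicE (measurable_rect hr).
- by move=> w; apply: mule_ge0; [rewrite lee_fin|exact: f0].
Qed.

Lemma borel_averageS (r : 'rV[R]_n.+1 * 'rV[R]_n.+1) : proper_rect r ->
  borel_average f r =
  itv_average (fun u => borel_average (fun z => f (consRn (u, z))) (tail_rect r)) (head_itv r).
Proof.
move=> hr; have ht := proper_tail_rect hr.
have h0 : ((head_itv r).1 < (head_itv r).2)%R by exact: hr.
rewrite /borel_average /itv_average integral_indicM integral_borel_lebesgueS; last 2 first.
- apply: emeasurable_funM => //; exact: measurable_indicE (measurable_rect hr).
- by move=> x; rewrite mule_ge0// lee_fin.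
have mT : measurable_fun [set: measurableTypeR R]
    (fun u => \int[borel_lebesgue n]_(z in rect (tail_rect r)) f (consRn (u, z))).
  have := measurable_slice_average ht; rewrite /borel_average => h.
  rewrite (_ : (fun _ => _) = fun u => (rect_volume (tail_rect r))%:E *
      (((rect_volume (tail_rect r))^-1)%:E *
     \int[borel_lebesgue n]_(z in rect (tail_rect r)) f (consRn (u, z)))); last first.
    apply/funext => u; rewrite muleA -EFinM divff ?mul1e//.
    by rewrite gt_eqF// rect_volume_gt0.
  exact: measurable_funeM.
rewrite ge0_integralZl//; last 4 first.
- exact: measurable_open_itv.
- exact: measurable_funTS.
- by move=> u _; exact: integral_ge0.
- by rewrite lee_fin invr_ge0 ltW// rect_volume_gt0.
rewrite muleA -EFinM rect_volumeS invfM; congr (_ * _).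
rewrite [RHS]integral_indicM; apply: eq_integral => u _.
rewrite [X in _ = _ * X]integral_indicM -ge0_integralZl ?lee_fin//; last 2 first.
- apply: emeasurable_funM; last exact: measurable_slice.
  exact: measurable_indicE (measurable_rect ht).
- by move=> z _; rewrite mule_ge0// lee_fin.
apply: eq_integral => z _.
by rewrite muleA -EFinM indic_rect_consRn.
Qed.

End slices.

(** The classical iteration of the one-dimensional bound over the coordinates: the first variable
    costs a factor [K] and the others cost [K ^ n] by induction. *)
Lemma borel_rectangle_maximal n (p K : R) (f : 'rV[R]_n -> \bar R)
    (s : seq ('rV[R]_n * 'rV[R]_n)) : (1 < p)%R -> (0 <= K)%R ->
  (forall (g : R -> \bar R) (t : seq (R * R)),
    measurable_fun [set: measurableTypeR R] g -> (forall x, 0 <= g x) ->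
    (forall r, r \in t -> (r.1 < r.2)%R) ->
    \int[leb]_x (\big[maxe/0]_(r <- t) ((\1_(open_itv r) x)%:E * itv_average g r)) `^ p
      <= K%:E * \int[leb]_x (g x `^ p)) ->
  measurable_fun [set: 'rV[R]_n] f -> (forall x, 0 <= f x) ->
  (forall r, r \in s -> proper_rect r) ->
  \int[borel_lebesgue n]_x
    (\big[maxe/0]_(r <- s) ((\1_(rect r) x)%:E * borel_average f r)) `^ p
  <= (K ^+ n)%:E * \int[borel_lebesgue n]_x (f x `^ p).
Proof.
move=> p1 K0 hK; have p0 : (0 < p)%R by rewrite (lt_trans ltr01).
elim: n f s => [|n IH] f s mf f0 hs.
  (* On the one-point space every average is the value of [f]. *)
  have mono x : (\big[maxe/0]_(r <- s) ((\1_(rect r) x)%:E * borel_average f r)) `^ p <= f x `^ p.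
    apply: seq_max_poweR_le => //; first exact: poweR_ge0.
    move=> r rs; apply: lee_poweR; first exact: ltW.
      by rewrite mule_ge0 ?lee_fin//; apply: borel_average_ge0 => //; exact: hs.
    rewrite /borel_average /rect_volume big_ord0 invr1 mul1e.
    have -> : rect r = setT by apply/seteqP; split => // y _ [].
    rewrite integral_dirac// diracT mul1e (_ : x = 0%R); last by apply/rowP; case.
    by rewrite indicE in_setT mul1e.
  rewrite expr0 mul1e; apply: ge0_le_integral => //.
  - by move=> x _; exact: poweR_ge0.
  - apply: emeasurable_powR; apply: measurable_seq_max => r rs.
    apply: emeasurable_funM; last exact: measurable_cst.
    exact: measurable_indicE (measurable_rect (hs _ rs)).
  - exact: emeasurable_powR.
pose F u z := f (consRn (u, z)).
pose s' := map (@tail_rect n) s.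
pose s0 := map (@head_itv n) s.
have hs' r : r \in s' -> proper_rect r.
  by move=> /mapP[q /hs qs ->]; exact: proper_tail_rect.
have hs0 r : r \in s0 -> (r.1 < r.2)%R by move=> /mapP[q /hs qs ->]; exact: qs.
(* [H] is the maximal function of the slices in the last [n] variables, and [G] below is the
   one-dimensional maximal function of [H] in the first variable. As a rectangle average is an
   average of slice averages, [G] dominates the maximal function of [f]. *)
pose H (w : measurableTypeR R * 'rV[R]_n) :=
  \big[maxe/0]_(r <- s') ((\1_(rect r) w.2)%:E * borel_average (F w.1) r).
have H0 w : 0 <= H w by exact: seq_max_ge0.
have mH : measurable_fun setT H.
  apply: measurable_seq_max => r /hs' hr; apply: emeasurable_funM.
    apply: (@measurableT_comp _ _ _ _ _ _ (fun z => (\1_(rect r) z)%:E) _ snd) => //.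
    exact: measurable_indicE (measurable_rect hr).
  apply: (@measurableT_comp _ _ _ _ _ _ (fun u => borel_average (F u) r) _ fst) => //.
  exact: measurable_slice_average.
have mHz z : measurable_fun [set: measurableTypeR R] (fun u => H (u, z)).
  exact: (measurableT_comp mH).
pose G (w : measurableTypeR R * 'rV[R]_n) :=
  \big[maxe/0]_(r <- s0) ((\1_(open_itv r) w.1)%:E * itv_average (fun u => H (u, w.2)) r).
have G0 w : 0 <= G w by exact: seq_max_ge0.
have mG : measurable_fun setT G.
  apply: measurable_seq_max => r rs; apply: emeasurable_funM.
    apply: (@measurableT_comp _ _ _ _ _ _ (fun u : measurableTypeR R => (\1_(open_itv r) u)%:E) _ fst) => //.
    exact: measurable_indicE (measurable_open_itv r).
  apply: measurable_funeM.
  apply: (@measurableT_comp _ _ _ _ _ _ (fun z => \int[leb]_(u in open_itv r) H (u, z)) _ snd) => //.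
  under eq_fun do rewrite integral_indicM.
  apply: (@measurable_fun_fubini_tonelli_G _ _ (measurableTypeR R) 'rV[R]_n R
    leb (fun w => (\1_(open_itv r) w.1)%:E * H w)).
  - apply: emeasurable_funM => //.
    apply: (@measurableT_comp _ _ _ _ _ _ (fun u : measurableTypeR R => (\1_(open_itv r) u)%:E) _ fst) => //.
    exact: measurable_indicE (measurable_open_itv r).
  - by move=> w; rewrite mule_ge0// lee_fin.
have mM : measurable_fun [set: 'rV[R]_n.+1]
    (fun x => (\big[maxe/0]_(r <- s) ((\1_(rect r) x)%:E * borel_average f r)) `^ p).
  apply: emeasurable_powR; apply: measurable_seq_max => r rs.
  apply: emeasurable_funM; last exact: measurable_cst.
  exact: measurable_indicE (measurable_rect (hs _ rs)).
rewrite integral_borel_lebesgueS//; last by move=> x; exact: poweR_ge0.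
rewrite [X in _ <= _ * X]integral_borel_lebesgueS//; last 2 first.
- exact: emeasurable_powR.
- by move=> x; exact: poweR_ge0.
pose Mc (w : measurableTypeR R * 'rV[R]_n) :=
    (\big[maxe/0]_(r <- s) ((\1_(rect r) (consRn w))%:E * borel_average f r)) `^ p.
have mMc : measurable_fun setT Mc.
  by apply: (measurableT_comp mM); exact: measurable_consRn.
have mMu u : measurable_fun [set: 'rV[R]_n] (fun z => Mc (u, z)).
  exact: (measurableT_comp mMc).
have mGp : measurable_fun setT (fun w => G w `^ p) by exact: emeasurable_powR.
have mHp : measurable_fun setT (fun w => H w `^ p) by exact: emeasurable_powR.
have mfc : measurable_fun setT (fun w : measurableTypeR R * 'rV[R]_n => f (consRn w) `^ p).
  by apply: emeasurable_powR; apply: measurableT_comp => //; exact: measurable_consRn.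
apply: (@le_trans _ _ (\int[leb]_u \int[borel_lebesgue n]_z (G (u, z) `^ p))).
  apply: ge0_le_integral => //.
  - by move=> u _; apply: integral_ge0 => z _; exact: poweR_ge0.
  - apply: (@measurable_fun_fubini_tonelli_F _ _ (measurableTypeR R) 'rV[R]_n R
     (borel_lebesgue n) (fun w => (\big[maxe/0]_(r <- s) ((\1_(rect r) (consRn w))%:E * borel_average f r)) `^ p)).
    + by apply: (measurableT_comp mM); exact: measurable_consRn.
    + by move=> w; exact: poweR_ge0.
  - apply: (@measurable_fun_fubini_tonelli_F _ _ (measurableTypeR R) 'rV[R]_n R
     (borel_lebesgue n) (fun w => G w `^ p)) => //.
    by move=> w; exact: poweR_ge0.
  move=> u _; apply: ge0_le_integral => //.
  - by move=> z _; exact: poweR_ge0.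
  - exact: mMu.
  - exact: (measurableT_comp mGp).
  move=> z _; apply: lee_poweR; [exact: ltW|exact: seq_max_ge0|].
  apply: seq_max_le => // r rs.
  apply: le_trans (seq_max_ge _ (map_f (@head_itv n) rs)).
  rewrite indic_rect_consRn EFinM -muleA /= lee_wpmul2l ?lee_fin//.
  rewrite indicE; have [zr|zr] := boolP (z \in rect (tail_rect r)); last first.
    rewrite mul0e; apply: mule_ge0; last exact: integral_ge0.
    by rewrite lee_fin invr_ge0 subr_ge0 ltW//; exact: hs.
  rewrite mul1e borel_averageS//; last exact: hs.
  apply: lee_wpmul2l; first by rewrite lee_fin invr_ge0 subr_ge0 ltW//; exact: hs.
  apply: ge0_le_integral.
  - exact: measurable_open_itv.
  - move=> v _; apply: borel_average_ge0 => //.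
    by apply: proper_tail_rect; exact: hs.
  - apply: measurable_funTS; apply: measurable_slice_average => //.
    by apply: proper_tail_rect; exact: hs.
  - exact: measurable_funTS.
  move=> v _; apply: le_trans (seq_max_ge _ (map_f (@tail_rect n) rs)).
  by rewrite indicE zr mul1e.
(* The one-dimensional bound acts in [u] for fixed [z], so [u] has to be the inner variable; the
   order is restored later for the induction hypothesis, which acts in [z]. *)
rewrite (@fubini_tonelli _ _ (measurableTypeR R) 'rV[R]_n R leb (borel_lebesgue n)
  (fun w => G w `^ p))//; last by move=> w; exact: poweR_ge0.
apply: (@le_trans _ _ (\int[borel_lebesgue n]_z ((K)%:E * \int[leb]_u (H (u, z) `^ p)))).
  apply: ge0_le_integral => //.
  - by move=> u _; apply: integral_ge0 => z _; exact: poweR_ge0.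
  - apply: (@measurable_fun_fubini_tonelli_G _ _ (measurableTypeR R) 'rV[R]_n R
      leb (fun w => G w `^ p)) => //.
    by move=> w; exact: poweR_ge0.
  - apply: measurable_funeM.
    apply: (@measurable_fun_fubini_tonelli_G _ _ (measurableTypeR R) 'rV[R]_n R
      leb (fun w => H w `^ p)) => //.
    by move=> w; exact: poweR_ge0.
  - by move=> z _; exact: (hK _ _ (mHz z) (fun u => H0 (u, z)) hs0).
rewrite ge0_integralZl//; last 2 first.
- apply: (@measurable_fun_fubini_tonelli_G _ _ (measurableTypeR R) 'rV[R]_n R
      leb (fun w => H w `^ p)) => //.
  by move=> w; exact: poweR_ge0.
- by move=> z _; apply: integral_ge0 => u _; exact: poweR_ge0.
rewrite exprS [X in _ <= X * _]EFinM -[leRHS]muleA; apply: lee_wpmul2l; first by rewrite lee_fin.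
rewrite -(@fubini_tonelli _ _ (measurableTypeR R) 'rV[R]_n R leb (borel_lebesgue n)
  (fun w => H w `^ p))//; last by move=> w; exact: poweR_ge0.
have mFz : measurable_fun [set: measurableTypeR R]
    (fun u => \int[borel_lebesgue n]_z (f (consRn (u, z)) `^ p)).
  apply: (@measurable_fun_fubini_tonelli_F _ _ (measurableTypeR R) 'rV[R]_n R
      (borel_lebesgue n) (fun w => f (consRn w) `^ p)) => //.
  by move=> w; exact: poweR_ge0.
rewrite -ge0_integralZl ?lee_fin ?exprn_ge0//; last first.
  by move=> u _; apply: integral_ge0 => z _; exact: poweR_ge0.
apply: ge0_le_integral => //.
- by move=> u _; apply: integral_ge0 => z _; exact: poweR_ge0.
- apply: (@measurable_fun_fubini_tonelli_F _ _ (measurableTypeR R) 'rV[R]_n R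
      (borel_lebesgue n) (fun w => H w `^ p)) => //.
  by move=> w; exact: poweR_ge0.
- exact: measurable_funeM.
- move=> u _.
  exact: (IH (fun z => f (consRn (u, z))) s' (measurable_slice mf u) (fun z => f0 _) hs').
Qed.

Local Notation mu n := (@lebesgueRn R n).

Lemma measurable_rectRn n (r : 'rV[R]_n * 'rV[R]_n) :
  proper_rect r -> measurable (rect r : set (Rn R n)).
Proof. by move=> h; apply: borel_measurable_Rn; exact: measurable_rect. Qed.

Lemma lebesgueRn_rect n (r : 'rV[R]_n * 'rV[R]_n) :
  proper_rect r -> mu n (rect r) = (rect_volume r)%:E.
Proof. by move=> h; apply: lebesgueRn_rectangle => i; exact: ltW. Qed.

Lemma average_rect n (f : 'rV[R]_n -> \bar R) (r : 'rV[R]_n * 'rV[R]_n) :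
  proper_rect r -> (forall x, 0 <= f x) ->
  average f (rect r) = ((rect_volume r)^-1)%:E * \int[mu n]_(x in rect r) f x.
Proof.
move=> h f0; rewrite /average lebesgueRn_rect//.
rewrite inver gt_eqF ?rect_volume_gt0//; congr (_ * _).
by apply: eq_integral => x _; rewrite gee0_abs.
Qed.

(** Replacing [f] by a Borel hull changes neither the averages nor the integral of the power, and
    makes the Tonelli argument available. The constant depends on [n] and [p] only, not on the
    length of [s]. *)
Lemma strong_maximal_finite n (p : R) : (1 < p)%R ->
  exists2 C : R, (0 <= C)%R & forall (f : 'rV[R]_n -> \bar R)
    (s : seq ('rV[R]_n * 'rV[R]_n)),
  measurable_fun [set: Rn R n] f -> (forall x, 0 <= f x) ->
  (forall r, r \in s -> proper_rect r) ->
  \int[mu n]_x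
    (\big[maxe/0]_(r <- s) ((\1_(rect r) x)%:E * average f (rect r))) `^ p
  <= C%:E * \int[mu n]_x (f x `^ p).
Proof.
move=> p1.
have [K K0 hK] : exists2 K : R, (0 <= K)%R & forall (g : R -> \bar R) (t : seq (R * R)),
    measurable_fun [set: measurableTypeR R] g -> (forall x, 0 <= g x) ->
    (forall r, r \in t -> (r.1 < r.2)%R) ->
    \int[leb]_x (\big[maxe/0]_(r <- t) ((\1_(open_itv r) x)%:E * itv_average g r)) `^ p
      <= K%:E * \int[leb]_x (g x `^ p).
  exists (6 * (p / (p - 1)) * 6 `^ (p - 1))%R; last first.
    by move=> g t mg g0 ht; exact: interval_maximal.
  have p0 : (0 < p)%R by rewrite (lt_trans ltr01).
  by rewrite mulr_ge0 ?powR_ge0// mulr_ge0// divr_ge0 ?subr_ge0 ?ltW.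
exists (K ^+ n)%R; first exact: exprn_ge0.
move=> f s mf f0 hs.
have [g [mg fg aefg]] := borel_hull_fun mf f0.
have g0 x : 0 <= g x := le_trans (f0 x) (fg x).
have mg' := borel_measurable_fun_Rn mg.
have -> : \int[mu n]_x (f x `^ p) = \int[borel_lebesgue n]_x (g x `^ p).
  rewrite -integral_lebesgueRn_borel; last 2 first.
  - exact: emeasurable_powR.
  - by move=> x; exact: poweR_ge0.
  apply: ge0_ae_eq_integral => //.
  - exact: emeasurable_powR.
  - exact: emeasurable_powR.
  - by move=> x _; exact: poweR_ge0.
  - by move=> x _; exact: poweR_ge0.
  - by apply: filterS aefg => x /= h _; rewrite h.
have avE r : r \in s -> average f (rect r) = borel_average g r.
  move=> rs; have hr := hs _ rs.
  rewrite average_rect// /borel_average; congr (_ * _).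
  rewrite [RHS]integral_indicM -integral_lebesgueRn_borel; last 2 first.
  - apply: emeasurable_funM => //; exact: measurable_indicE (measurable_rect hr).
  - by move=> x; rewrite mule_ge0// lee_fin.
  rewrite -integral_indicM; apply: ge0_ae_eq_integral => //.
  - exact: measurable_rectRn.
  - exact: measurable_funTS.
  - exact: measurable_funTS.
  - by apply: filterS aefg => x /= h _; exact: h.
have -> : \int[mu n]_x
    (\big[maxe/0]_(r <- s) ((\1_(rect r) x)%:E * average f (rect r))) `^ p =
    \int[mu n]_x (\big[maxe/0]_(r <- s) ((\1_(rect r) x)%:E * borel_average g r)) `^ p.
  apply: eq_integral => x _.
  by rewrite (eq_big_seq (fun r => (\1_(rect r) x)%:E * borel_average g r))// => r rs; rewrite avE.
rewrite integral_lebesgueRn_borel; last 2 first.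
- apply: emeasurable_powR; apply: measurable_seq_max => r rs.
  apply: emeasurable_funM; last exact: measurable_cst.
  exact: measurable_indicE (measurable_rect (hs _ rs)).
- by move=> x; exact: poweR_ge0.
exact: borel_rectangle_maximal.
Qed.

End RectangleMaximal.

(** * Scaling and unions of rectangles *)

Section Scaling.
Context {R : realType}.
Local Notation leb := (@lebesgue_measure R).
Local Open Scope ereal_scope.

(** By uniqueness of Lebesgue measure: [l] times the image measure under [u |-> l * u + c] has the
    right value on half-open intervals. *)
Lemma lebesgue_affine (l c : R) (A : set (measurableTypeR R)) : (0 < l)%R ->
  measurable A ->
  leb ((fun u => l * u + c)%R @^-1` A) = (l^-1)%:E * leb A.
Proof.
move=> l0 mA.
pose phi (u : measurableTypeR R) : measurableTypeR R := (l * u + c)%R.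
have mphi : measurable_fun setT phi.
  by apply: measurable_funD => //; exact: measurable_funM.
pose m' := mscale (NngNum (ltW l0)) (pushforward leb phi).
have : leb A = m' mphi A.
  apply: lebesgue_measure_unique => // X [[x1 x2] _ <-].
  have E : phi @^-1` [set` `]x1, x2]] = [set` `](x1 - c) / l, (x2 - c) / l]]%R.
    apply/seteqP; split => u; rewrite /phi/= !in_itv/= ltr_pdivrMr// ler_pdivlMr//.
      by rewrite ltrBlDr lerBrDr (mulrC u).
    by rewrite ltrBlDr lerBrDr (mulrC u).
  transitivity (l%:E * leb [set` `](x1 - c) / l, (x2 - c) / l]]%R); last by rewrite -E.
  rewrite !lebesgue_measure_itv/= !lte_fin ltr_pM2r ?invr_gt0// ltrD2r.
  case: ifP => _; last by rewrite mule0.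
  by rewrite -!EFinB -EFinM; congr EFin; field; rewrite gt_eqF.
rewrite /m' /mscale/= => ->.
by rewrite muleA -EFinM mulVf ?mul1e// gt_eqF.
Qed.

Lemma integral_affine (l c : R) (g : R -> \bar R) : (0 < l)%R ->
  measurable_fun [set: measurableTypeR R] g -> (forall x, 0 <= g x) ->
  \int[leb]_u g (l * u + c)%R = (l^-1)%:E * \int[leb]_u g u.
Proof.
move=> l0 mg g0.
pose phi (u : measurableTypeR R) : measurableTypeR R := (l * u + c)%R.
have mphi : measurable_fun setT phi.
  by apply: measurable_funD => //; exact: measurable_funM.
have li0 : (0 <= l^-1)%R by rewrite invr_ge0 ltW.
rewrite -(@ge0_integral_mscale _ _ _ leb setT measurableT (NngNum li0) g)//.
have := @ge0_integral_pushforward _ _ (measurableTypeR R) (measurableTypeR R) _ phi mphi leb setT g measurableT mg.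
move=> /(_ (fun x _ => g0 x)); rewrite preimage_setT => <-.
apply: eq_measure_integral => // A mA _.
exact: (lebesgue_affine c l0 mA).
Qed.

(** A diagonal affine map; later it is the homothety towards a point in some of the coordinates and
    the identity in the others. *)
Definition row_affine n (l c x : 'rV[R]_n) : 'rV[R]_n :=
  (\row_i (l ord0 i * x ord0 i + c ord0 i))%R.

Lemma measurable_row_affine n (l c : 'rV[R]_n) :
  measurable_fun setT (row_affine l c).
Proof.
apply: measurable_fun_coord => i.
rewrite (_ : _ \o _ = fun x => (l ord0 i * coordRn i x + c ord0 i)%R); last first.
  by apply/funext => x; rewrite /= /coordRn mxE.
apply: measurable_funD; last exact: measurable_cst.
by apply: measurable_funM; [exact: measurable_cst|exact: measurable_coord].
Qed.

Lemma row_affine_consRn n (l c : 'rV[R]_n.+1) u z :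
  row_affine l c (consRn (u, z)) =
  consRn ((l ord0 ord0 * u + c ord0 ord0)%R, row_affine (tail_row l) (tail_row c) z).
Proof.
apply/rowP => i; rewrite mxE.
case: (unliftP ord0 i) => [j ->|->].
  have := consRn_lift (u, z) j; rewrite /coordRn => ->.
  by have := consRn_lift ((l ord0 ord0 * u + c ord0 ord0)%R, row_affine (tail_row l) (tail_row c) z) j;
    rewrite /coordRn => ->; rewrite /= !mxE.
have := consRn0 (u, z); rewrite /coordRn => ->.
by have := consRn0 ((l ord0 ord0 * u + c ord0 ord0)%R, row_affine (tail_row l) (tail_row c) z);
  rewrite /coordRn => ->.
Qed.

Lemma integral_row_affine n (l c : 'rV[R]_n) (g : 'rV[R]_n -> \bar R) :
  (forall i, (0 < l ord0 i)%R) ->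
  measurable_fun [set: 'rV[R]_n] g -> (forall x, 0 <= g x) ->
  \int[borel_lebesgue n]_x g (row_affine l c x) =
  ((\prod_i l ord0 i)^-1)%:E * \int[borel_lebesgue n]_x g x.
Proof.
elim: n l c g => [|n IH] l c g l0 mg g0.
  rewrite big_ord0 invr1 mul1e; apply: eq_integral => x _; congr g.
  by apply/rowP; case.
have mgl : measurable_fun [set: 'rV[R]_n.+1] (g \o row_affine l c).
  by apply: (measurableT_comp mg); exact: measurable_row_affine.
rewrite (integral_borel_lebesgueS mgl); last by move=> x; exact: g0.
rewrite integral_borel_lebesgueS//.
pose G (w : measurableTypeR R * 'rV[R]_n) := g (consRn w).
have mG : measurable_fun setT G.
  by apply: (measurableT_comp mg); exact: measurable_consRn.
have mGu u : measurable_fun [set: 'rV[R]_n] (fun z => G (u, z)).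
  exact: (measurableT_comp mG).
pose J u := \int[borel_lebesgue n]_z G (u, z).
have mJ : measurable_fun [set: measurableTypeR R] J.
  by apply: (@measurable_fun_fubini_tonelli_F _ _ (measurableTypeR R) 'rV[R]_n R (borel_lebesgue n) G) => // w; exact: g0.
have J0 u : 0 <= J u by apply: integral_ge0 => z _; exact: g0.
pose l' := tail_row l.
have l'0 i : (0 < l' ord0 i)%R by rewrite mxE.
have c0 : (0 <= (\prod_i l' ord0 i)^-1)%R.
  by rewrite invr_ge0; apply: prodr_ge0 => i _; exact: ltW.
transitivity (\int[leb]_u (((\prod_i l' ord0 i)^-1)%:E * J (l ord0 ord0 * u + c ord0 ord0)%R)).
  apply: eq_integral => u _; rewrite /J -(IH l' (tail_row c) (fun z => G (_, z)))//; last first.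
    by move=> z; exact: g0.
  by apply: eq_integral => z _; rewrite /= row_affine_consRn.
have mJa : measurable_fun [set: measurableTypeR R] (fun u => J (l ord0 ord0 * u + c ord0 ord0)%R).
  apply: (measurableT_comp mJ).
  by apply: measurable_funD => //; exact: measurable_funM.
have c0' : 0 <= ((\prod_i l' ord0 i)^-1)%:E by rewrite lee_fin.
rewrite (@ge0_integralZl _ _ R leb setT measurableT _ mJa _ (fun u _ => J0 _) c0').
rewrite (integral_affine _ (l0 ord0) mJ J0) muleA -EFinM -invfM; congr ((_^-1)%:E * _).
by rewrite big_ord_recl mulrC; congr (_ * _)%R; apply: eq_bigr => i _; rewrite mxE.
Qed.

Lemma borel_lebesgue_row_affine n (l c : 'rV[R]_n) (A : set 'rV[R]_n) :
  (forall i, (0 < l ord0 i)%R) -> measurable A ->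
  borel_lebesgue n (row_affine l c @^-1` A) =
  ((\prod_i l ord0 i)^-1)%:E * borel_lebesgue n A.
Proof.
move=> l0 mA.
have mA' : measurable (row_affine l c @^-1` A).
  by rewrite -[X in measurable X]setTI; exact: measurable_row_affine.
have A0 x : 0 <= (\1_A x : R)%:E by rewrite lee_fin.
have := integral_row_affine c l0 (measurable_indicE mA) A0.
have -> : \int[borel_lebesgue n]_x (\1_A x)%:E = borel_lebesgue n A.
  by rewrite integral_indic// setIT.
move=> <-.
rewrite -[in LHS](setIT (_ @^-1` _)) -(integral_indic (borel_lebesgue n) measurableT mA').
by apply: eq_integral => x _; rewrite !indicE.
Qed.

End Scaling.

(** * Countable subcovers by open rectangles *)

Section Lindelof.
Context {R : realType} {n : nat}.
Local Open Scope ereal_scope.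
Local Notation mu := (@lebesgueRn R n).
Local Notation box := ('rV[R]_n * 'rV[R]_n)%type.

Lemma rational_subrect (r : box) (x : 'rV[R]_n) : rect r x ->
  exists a b : 'rV[rat]_n, let q := (map_mx (@ratr R) a, map_mx (@ratr R) b) in
    rect q x /\ rect q `<=` rect r.
Proof.
move=> rx.
have h i : exists ab : rat * rat, [/\ (r.1 ord0 i < ratr ab.1)%R,
    (ratr ab.1 < x ord0 i)%R, (x ord0 i < ratr ab.2)%R & (ratr ab.2 < r.2 ord0 i)%R].
  have /andP[h1 h2] := rx i.
  have [a] := rat_in_itvoo h1; rewrite in_itv/= => /andP[a1 a2].
  have [b] := rat_in_itvoo h2; rewrite in_itv/= => /andP[b1 b2].
  by exists (a, b).
have [ab hab] := choice h.
exists (\row_i (ab i).1)%R, (\row_i (ab i).2)%R; split.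
  by move=> i; rewrite /= !mxE; have [_ -> -> _] := hab i.
move=> y yq i; have := yq i; rewrite /= !mxE => /andP[h1 h2].
have [h3 _ _ h4] := hab i.
by rewrite (lt_trans h3)//= (lt_trans h2).
Qed.

(** Each point of a member of [F] lies in a rectangle with rational corners inside that member.
    There are countably many rational rectangles, and for each one that fits into some member a
    single such member is kept. *)
Lemma rect_lindelof (F : set box) : F !=set0 ->
  exists2 e : nat -> box, (forall k, F (e k)) &
    \bigcup_(r in F) rect r = \bigcup_k rect (e k).
Proof.
move=> [r0 Fr0].
pose T := ('rV[rat]_n * 'rV[rat]_n)%type.
pose qr (q : T) : box := (map_mx (@ratr R) q.1, map_mx (@ratr R) q.2).
(* Codes of no rational rectangle, or of one that fits into no member, receive the default [r0]. *)
have h (k : nat) : exists r, F r /\ forall q : T, unpickle k = Some q ->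
    (exists2 r', F r' & rect (qr q) `<=` rect r') -> rect (qr q) `<=` rect r.
  case E : (@unpickle T k) => [q|]; last by exists r0; split.
  have [[r Fr qrr]|no] := pselect (exists2 r', F r' & rect (qr q) `<=` rect r').
    by exists r; split => // _ [<-].
  by exists r0; split => // _ [<-].
have [e he] := choice h.
exists e; first by move=> k; have [] := he k.
apply/seteqP; split => [x [r Fr rx]|x [k _ ex]]; last first.
  by exists (e k) => //; have [] := he k.
have [a [b [qx qrr]]] := rational_subrect rx.
exists (pickle (a, b)) => //.
have [_ /(_ (a, b))] := he (pickle (a, b)); rewrite pickleK => /(_ erefl).
by apply => //; exists r.
Qed.

Lemma measurable_bigcup_rect (F : set box) : (forall r, F r -> proper_rect r) ->
  measurable (\bigcup_(r in F) rect r).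
Proof.
move=> hF; have [[r0 Fr0]|F0] := pselect (F !=set0); last first.
  rewrite (_ : \bigcup_(r in F) _ = set0); first exact: measurable0.
  by apply/seteqP; split => // x [r Fr _]; apply: F0; exists r.
have [|e Fe ->] := @rect_lindelof F; first by exists r0.
by apply: bigcupT_measurable => k; apply: measurable_rect; exact: hF.
Qed.

(** A countable subcover and monotone convergence along its initial segments. Covering arguments may
    thus be confined to finite lists. *)
Lemma integral_bigcup_rect_le (F : set box) (w : 'rV[R]_n -> \bar R) (M : \bar R) :
  (forall r, F r -> proper_rect r) -> 0 <= M ->
  measurable_fun [set: Rn R n] w -> (forall x, 0 <= w x) ->
  (forall s : seq box, (forall r, r \in s -> F r) ->
    \int[mu]_(x in seq_bigcup (@rect R n) s) w x <= M) ->
  \int[mu]_(x in \bigcup_(r in F) rect r) w x <= M.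
Proof.
move=> hF M0 mw w0 hs; have [[r0 Fr0]|F0] := pselect (F !=set0); last first.
  rewrite (_ : \bigcup_(r in F) _ = set0); first by rewrite integral_set0.
  by apply/seteqP; split => // x [r Fr _]; apply: F0; exists r.
have [|e Fe ->] := @rect_lindelof F; first by exists r0.
pose U (k : nat) : set (Rn R n) := seq_bigcup (@rect R n) (map e (iota 0 k)).
have UE : \bigcup_k rect (e k) = \bigcup_k U k.
  apply/seteqP; split => [x [k _ ex]|x [k _ /seq_bigcupP[r /mapP[i _ ->] ex]]].
    exists k.+1 => //; apply/seq_bigcupP; exists (e k) => //.
    by apply: map_f; rewrite mem_iota/= add0n ltnSn.
  by exists i.
rewrite UE.
have mU k : measurable (U k).
  by apply: measurable_seq_bigcup => r /mapP[i _ ->]; apply: measurable_rectRn; exact: hF.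
have ndU : nondecreasing_seq U.
  apply/nondecreasing_seqP => k; rewrite subsetEset; apply: seq_bigcup_subset.
  move=> r /mapP[i]; rewrite mem_iota add0n => /andP[_ ik] ->.
  by apply: (map_f e); rewrite mem_iota add0n/= ltnW.
have cv := @ge0_nondecreasing_set_cvg_integral _ _ _ U w mu ndU mU
  (fun i => measurable_funTS mw) (fun i x _ => w0 x).
apply: (cvge_le _ cv); apply: nearW => k.
by apply: hs => r /mapP[i _ ->].
Qed.

End Lindelof.

(** * Complexity *)

Section Complexity.
Context {R : realType} {n : nat}.
Local Open Scope ereal_scope.
Local Notation mu := (@lebesgueRn R n).
Local Notation box := ('rV[R]_n * 'rV[R]_n)%type.

(** Stated for pairs of corners rather than sets, so that side lengths can be read off and
    rectangles collected in lists. *)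
Definition box_complexity c (r : box) := proper_rect r /\
  exists alpha : 'I_c -> R, (forall k, (0 < alpha k)%R) /\
    forall i, exists k, (r.2 ord0 i - r.1 ord0 i = alpha k)%R.

Lemma rectangles_complexityP c (Q : set 'rV[R]_n) :
  rectangles_complexity c Q <-> exists2 r, box_complexity c r & Q = rect r.
Proof.
split=> [[a [b [ab -> alpha]]]|[[a b] [ab alpha] ->]]; first by exists (a, b).
by exists a, b.
Qed.

Lemma rectanglesP (Q : set 'rV[R]_n) :
  rectangles Q -> exists2 r, box_complexity n r & Q = rect r.
Proof.
move=> [a [b [ab ->]]]; exists (a, b) => //; split => //.
exists (fun i => b ord0 i - a ord0 i)%R; split; first by move=> k; rewrite subr_gt0.
by move=> i; exists i.
Qed.

Lemma average_ge0 (f : 'rV[R]_n -> \bar R) (r : box) : proper_rect r ->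
  0 <= average f (rect r).
Proof.
move=> h; rewrite /average lebesgueRn_rect// inver gt_eqF ?rect_volume_gt0//.
apply: mule_ge0; last exact: integral_ge0.
by rewrite lee_fin invr_ge0 ltW// rect_volume_gt0.
Qed.

Lemma average_le_strong_maximal c (f : 'rV[R]_n -> \bar R) (r : box) x :
  box_complexity c r -> rect r x -> average f (rect r) <= strong_maximal c f x.
Proof.
move=> hr rx; apply: ereal_sup_ubound; exists (rect r) => //; split => //.
by apply/rectangles_complexityP; exists r.
Qed.

(** Makes the supremum in the maximal function run over a nonempty family. For complexity 0 and
    positive dimension that family is empty and the supremum is [-oo]. *)
Lemma cube_box_complexity c (x : 'rV[R]_n) : exists r,
  box_complexity c.+1 r /\ rect r x.
Proof.
exists (\row_i (x ord0 i - 1), \row_i (x ord0 i + 1))%R; split; last first.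
  by move=> i; rewrite !mxE; apply/andP; split; lra.
split; first by move=> i; rewrite !mxE; lra.
exists (fun _ => 2%R); split => // i; exists ord0; rewrite !mxE; lra.
Qed.

Lemma strong_maximal_ge0 c (f : 'rV[R]_n -> \bar R) x :
  0 <= strong_maximal c.+1 f x.
Proof.
have [r [hr rx]] := cube_box_complexity c x.
by apply: le_trans (average_le_strong_maximal f hr rx); apply: average_ge0; case: hr.
Qed.

(** Superlevel sets are unions of open rectangles, hence Borel. *)
Lemma measurable_strong_maximal c (f : 'rV[R]_n -> \bar R) :
  measurable_fun [set: 'rV[R]_n] (strong_maximal c f).
Proof.
move=> mD; apply: (measurability _ (ErealGenOInfty.measurableE R)) => //.
move=> _ [_ [y ->] <-]; rewrite setTI.
rewrite (_ : _ @^-1` _ = \bigcup_(r in [set r | box_complexity c r /\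
    y%:E < average f (rect r)]) rect r).
  by apply: measurable_bigcup_rect => r [[]].
apply/seteqP; split => [x/=|x [r [hr yr] rx]/=]; rewrite in_itv/= andbT.
  move=> /ereal_sup_gt[_ [Q [/rectangles_complexityP[r hr ->] rx] <-] yr].
  by exists r.
by apply: lt_le_trans yr _; exact: average_le_strong_maximal.
Qed.

(** The first [c] stages of [iterated_maximal], which is the case [c = n]. *)
Definition iter_maximal c (f : 'rV[R]_n -> \bar R) : 'rV[R]_n -> \bar R :=
  foldl (fun g k => strong_maximal k g) f (iota 1 c).

Lemma iter_maximalS c f : iter_maximal c.+1 f = strong_maximal c.+1 (iter_maximal c f).
Proof.
rewrite /iter_maximal (_ : iota 1 c.+1 = iota 1 c ++ [:: c.+1]) ?foldl_cat//.
by rewrite -[in LHS](addn1 c) iotaD add1n.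
Qed.

Lemma iter_maximal_ge0 c (f : 'rV[R]_n -> \bar R) :
  (forall x, 0 <= f x) -> forall x, 0 <= iter_maximal c f x.
Proof.
by move=> f0; case: c => [//|c] x; rewrite iter_maximalS strong_maximal_ge0.
Qed.

Lemma measurable_iter_maximal c (f : 'rV[R]_n -> \bar R) :
  measurable_fun [set: Rn R n] f -> measurable_fun [set: Rn R n] (iter_maximal c f).
Proof.
move=> mf; case: c => [//|c]; rewrite iter_maximalS.
by apply: borel_measurable_fun_Rn; exact: measurable_strong_maximal.
Qed.

(** The concentric dilation by 3: each side is prolonged by its own length at both ends. *)
Definition triple_rect (r : box) : box :=
  (\row_i (2 * r.1 ord0 i - r.2 ord0 i), \row_i (2 * r.2 ord0 i - r.1 ord0 i))%R.

Lemma proper_triple_rect r : proper_rect r -> proper_rect (triple_rect r).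
Proof. by move=> h i; rewrite !mxE; have := h i; lra. Qed.

Lemma sub_triple_rect r : proper_rect r -> rect r `<=` rect (triple_rect r).
Proof.
move=> h x rx i; rewrite !mxE; have /andP[? ?] := rx i; have := h i => ?.
by apply/andP; split; lra.
Qed.

Lemma rect_volume_triple r : rect_volume (triple_rect r) = (3 ^+ n * rect_volume r)%R.
Proof.
have -> : (3 ^+ n = \prod_(i < n) 3 :> R)%R by rewrite prodr_const card_ord.
rewrite /rect_volume -big_split/=.
by apply: eq_bigr => i _; rewrite !mxE; lra.
Qed.

Lemma box_complexity_triple c r : box_complexity c r -> box_complexity c (triple_rect r).
Proof.
move=> [hr [alpha [a0 ha]]]; split; first exact: proper_triple_rect.
exists (fun k => 3 * alpha k)%R; split; first by move=> k; rewrite mulr_gt0.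
by move=> i; have [k hk] := ha i; exists k; rewrite -hk !mxE; lra.
Qed.

(* [kappa i] names the parameter giving the [i]-th side; the largest parameter
   [L] is the last one. *)
Definition sides_class c (kappa : 'I_n -> 'I_c.+1) (r : box) (L : R) :=
  proper_rect r /\ exists alpha : 'I_c.+1 -> R, [/\ forall k, (0 < alpha k)%R,
    forall k, (alpha k <= L)%R, alpha ord_max = L &
    forall i, (r.2 ord0 i - r.1 ord0 i = alpha (kappa i))%R].

Lemma box_complexity_sides c r : box_complexity c.+1 r ->
  exists kappa : {ffun 'I_n -> 'I_c.+1}, exists L, sides_class kappa r L.
Proof.
move=> [hr [alpha [a0 ha]]].
have [k hk] := choice ha.
case: (@Order.TotalTheory.arg_maxP _ _ _ (ord0 : 'I_c.+1) xpredT alpha isT) => m _ hm.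
(* The transposition moves a largest parameter to the last index. *)
exists [ffun i => tperm m ord_max (k i)], (alpha m); split => //.
exists (fun j => alpha (tperm m ord_max j)); split => //.
- by move=> j; exact: hm.
- by rewrite tpermR.
- by move=> i; rewrite ffunE tpermK hk.
Qed.

Definition half_dense (A : set 'rV[R]_n) (r : box) :=
  (2^-1)%:E * mu (rect r) <= mu (rect r `&` A).

(** No rectangle has complexity 0 in positive dimension. The value [A] there starts the induction,
    and it is also what cubes need, since shrinking a cube in all directions leads to a single
    point. *)
Definition density_set c (A : set 'rV[R]_n) : set 'rV[R]_n :=
  if c is 0 then A
  else \bigcup_(r in [set r | box_complexity c r /\ half_dense A r]) rect r.

Definition box_union (s : seq (box * R)) : set 'rV[R]_n :=
  seq_bigcup (fun q => rect q.1) s.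

Definition triple_union (s : seq (box * R)) : set 'rV[R]_n :=
  seq_bigcup (fun q => rect (triple_rect q.1)) s.

(* Shrinking [r] homothetically towards [x] in the directions of its longest
   side lowers the complexity, keeps the box inside [r], and keeps it half full:
   boxes of [s] meeting [r] are at least as long in these directions, so that
   their triples contain the homothetic image of their intersection with [r]. *)
Lemma sides_class_density c (kappa : 'I_n -> 'I_c.+1) r L (s : seq (box * R)) :
  sides_class kappa r L ->
  (forall q, q \in s -> sides_class kappa q.1 q.2 /\ (L <= q.2)%R) ->
  half_dense (box_union s) r -> rect r `<=` density_set c (triple_union s).
Proof.
move=> [hr [alpha [a0 aL amax ha]]] hs hd x rx.
case: c kappa alpha a0 aL amax ha hs => [|c] kappa alpha a0 aL amax ha hs.
  (* For cubes the half density only serves to produce a selected cube that meets [r]; its side is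
     at least [L], so its triple contains [r]. *)
  rewrite /=.
  have [y [ry /seq_bigcupP[q qs qy]]] : (rect r `&` box_union s) !=set0.
    apply/set0P/eqP => e0; move: hd; rewrite /half_dense e0 measure0.
    have v0 := rect_volume_gt0 hr.
    by rewrite lebesgueRn_rect// -EFinM lee_fin => h; lra.
  apply/seq_bigcupP; exists q => // i; rewrite !mxE.
  have [[_ [beta [_ _ bmax hb]]] Lq] := hs _ qs.
  have /andP[x1 x2] := rx i; have /andP[y1 y2] := ry i; have /andP[q1 q2] := qy i.
  have h1 := ha i; have h2 := hb i.
  rewrite (ord1 (kappa i)) -(ord1 ord_max) amax in h1.
  rewrite (ord1 (kappa i)) -(ord1 ord_max) bmax in h2.
  by apply/andP; split; lra.
(* There are now at least two parameters. The longest sides are shrunk to the length [alpha ord0],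
   so that the last parameter drops out. *)
pose l := alpha ord0.
have l0 : (0 < l)%R by exact: a0.
have L0 : (0 < L)%R by rewrite -amax.
have lL : (l <= L)%R by exact: aL.
pose la : 'rV[R]_n := (\row_i (if kappa i == ord_max then l / L else 1))%R.
have la0 i : (0 < la ord0 i)%R by rewrite mxE; case: ifP => // _; rewrite divr_gt0.
have la1 i : (la ord0 i <= 1)%R.
  by rewrite mxE; case: ifP => // _; rewrite ler_pdivrMr// mul1r.
(* Chosen so that [row_affine la ce] fixes [x]. *)
pose ce : 'rV[R]_n := (\row_i ((1 - la ord0 i) * x ord0 i))%R.
have phiE y i : row_affine la ce y ord0 i = (x ord0 i + la ord0 i * (y ord0 i - x ord0 i))%R.
  by rewrite mxE [ce _ _]mxE; ring.
pose r' : box := (row_affine la ce r.1, row_affine la ce r.2).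
have side i : (r'.2 ord0 i - r'.1 ord0 i = la ord0 i * (r.2 ord0 i - r.1 ord0 i))%R.
  by rewrite !phiE; ring.
have hr' : proper_rect r'.
  by move=> i; rewrite -subr_gt0 side mulr_gt0// subr_gt0.
have rx' : rect r' x.
  move=> i; rewrite /= !phiE; have /andP[x1 x2] := rx i; have := la0 i => li.
  apply/andP; split.
    by rewrite gtrDl pmulr_rlt0// subr_lt0.
  by rewrite ltrDl mulr_gt0// subr_gt0.
have vol' : rect_volume r' = ((\prod_i la ord0 i) * rect_volume r)%R.
  by rewrite /rect_volume -big_split/=; apply: eq_bigr => i _; exact: side.
exists r' => //; split; first split => //.
  exists (fun k => alpha (widen_ord (leqnSn _) k)); split => // i.
  rewrite side ha mxE; case: (eqVneq (kappa i) ord_max) => [->|km].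
    exists ord0; rewrite amax divfK ?gt_eqF//; congr alpha; exact: val_inj.
  have kc : (kappa i < c.+1)%N.
    rewrite ltn_neqAle -ltnS ltn_ord andbT; apply: contra km => /eqP km.
    by apply/eqP; exact: val_inj.
  by exists (Ordinal kc); rewrite mul1r; congr alpha; exact: val_inj.
have mU (g : box -> box) : (forall r, proper_rect r -> proper_rect (g r)) ->
    measurable (seq_bigcup (fun q : box * R => rect (g q.1)) s).
  move=> hg; apply: measurable_seq_bigcup => q /hs[[hq _] _].
  by apply: measurable_rect; exact: hg.
have mS := mU id (fun _ => id).
have mT := mU _ proper_triple_rect.
have mrS : measurable (rect r `&` box_union s).
  by apply: measurableI => //; exact: measurable_rect.
have mrT : measurable (rect r' `&` triple_union s).
  by apply: measurableI => //; exact: measurable_rect.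
have sub : rect r `&` box_union s `<=` row_affine la ce @^-1` (rect r' `&` triple_union s).
  move=> y [ry /seq_bigcupP[q qs qy]]; split.
    move=> i; have /andP[y1 y2] := ry i; rewrite !phiE; have li := la0 i.
    by rewrite ltrD2l ltrD2l !ltr_pM2l// !ltrD2r y1.
  apply/seq_bigcupP; exists q => // i; rewrite phiE !mxE.
  have [[_ [beta [_ _ bmax hb]]] Lq] := hs _ qs.
  have /andP[x1 x2] := rx i; have /andP[y1 y2] := ry i; have /andP[q1 q2] := qy i.
  have h1 := ha i; have h2 := hb i; have li := la0 i; have li1 := la1 i.
  move: li li1; rewrite mxE; case: (eqVneq (kappa i) ord_max) => [km|_] li li1.
    rewrite km amax in h1; rewrite km bmax in h2.
    set t := (l / L)%R in li li1 *.
    set X := x ord0 i in x1 x2 *; set Y := y ord0 i in y1 y2 q1 q2 *.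
    (* The point [Y] moves by [(1 - t) * (X - Y)], less than [L] and hence less than the side of
       [q]: its image stays in the triple. *)
    have e1 : (X + t * (Y - X) = Y + (1 - t) * (X - Y))%R by ring.
    have e2 : (`|(1 - t) * (X - Y)| <= `|X - Y|)%R.
      rewrite normrM ger0_norm ?subr_ge0// -[leRHS]mul1r ler_wpM2r//; lra.
    have e3 : (`|X - Y| < L)%R by rewrite ltr_norml; apply/andP; split; lra.
    have := le_lt_trans e2 e3; rewrite ltr_norml => /andP[e4 e5].
    by rewrite e1; apply/andP; split; lra.
  by rewrite mul1r; apply/andP; split; lra.
have pl0 : (0 < \prod_i la ord0 i)%R by apply: prodr_gt0 => i _; exact: la0.
(* The map multiplies measures by the same factor that takes the volume of [r] to that of [r'], so
   the density does not drop. *)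
have key : mu (rect r `&` box_union s) <=
    ((\prod_i la ord0 i)^-1)%:E * mu (rect r' `&` triple_union s).
  rewrite !lebesgueRn_borel// -(borel_lebesgue_row_affine ce la0 mrT).
  apply: le_measure; rewrite ?inE//.
  by rewrite -[X in measurable X]setTI; exact: measurable_row_affine.
rewrite /half_dense lebesgueRn_rect// vol' EFinM muleCA.
rewrite -lee_pdivlMl//; apply: le_trans key.
by move: hd; rewrite /half_dense lebesgueRn_rect.
Qed.

End Complexity.

(** * Sparse selection *)

Section Covering.
Context {R : realType} {n : nat}.
Local Open Scope ereal_scope.
Local Notation mu := (@lebesgueRn R n).
Local Notation box := ('rV[R]_n * 'rV[R]_n)%type.

Lemma integral_setU_le (A B : set (Rn R n)) (w : 'rV[R]_n -> \bar R) :
  measurable A -> measurable B ->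
  measurable_fun [set: Rn R n] w -> (forall x, 0 <= w x) ->
  \int[mu]_(x in A `|` B) w x <= \int[mu]_(x in A) w x + \int[mu]_(x in B) w x.
Proof.
move=> mA mB mw w0; have mAB : measurable (A `\` B) by exact: measurableD.
have -> : A `|` B = (A `\` B) `|` B by rewrite setUDl setDv setD0.
rewrite ge0_integral_setU//; last 2 first.
- exact: measurable_funTS.
- by rewrite disj_set2E setDKI.
rewrite leeD2r//; apply: ge0_subset_integral => //; exact: measurable_funTS.
Qed.

Lemma integral_seq_bigcup_le (I : eqType) (F : I -> set (Rn R n)) (s : seq I)
    (w : 'rV[R]_n -> \bar R) :
  (forall i, i \in s -> measurable (F i)) ->
  measurable_fun [set: Rn R n] w -> (forall x, 0 <= w x) ->
  \int[mu]_(x in seq_bigcup F s) w x <= \sum_(i <- s) \int[mu]_(x in F i) w x.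
Proof.
move=> mF mw w0; elim: s mF => [|i s IH] mF.
  by rewrite /seq_bigcup !big_nil integral_set0.
have ms j : j \in s -> measurable (F j) by move=> js; apply: mF; rewrite inE js orbT.
rewrite seq_bigcup_cons big_cons; apply: le_trans (leeD2l _ (IH ms)).
apply: integral_setU_le => //; first by apply: mF; rewrite mem_head.
exact: measurable_seq_bigcup.
Qed.

(** The latest selection stands at the head, so the tail holds the rectangles selected before it. *)
Fixpoint sparse (s : seq (box * R)) : Prop :=
  if s is q :: t then
    (2^-1)%:E * mu (rect q.1) <= mu (rect q.1 `\` box_union t) /\ sparse t
  else True.

Lemma measurable_box_union (s : seq (box * R)) :
  (forall q, q \in s -> proper_rect q.1) -> measurable (box_union s).
Proof. by move=> hs; apply: measurable_seq_bigcup => q /hs; exact: measurable_rect. Qed.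

Lemma measurable_triple_union (s : seq (box * R)) :
  (forall q, q \in s -> proper_rect q.1) -> measurable (triple_union s).
Proof.
move=> hs; apply: measurable_seq_bigcup => q /hs hq.
by apply: measurable_rect; exact: proper_triple_rect.
Qed.

(** The list increases and the recursion treats the tail first, so rectangles are considered from
    the longest to the shortest. The witness [u] for [q] is the selection as it stands right after
    [q] was considered: its members are at least as long as [q], and it half covers [q], either
    because [q] was rejected or because it contains [q]. *)
Lemma sparse_selection (s : seq (box * R)) :
  sorted (fun q q' : box * R => q.2 <= q'.2)%R s ->
  (forall q, q \in s -> proper_rect q.1) ->
  exists t, [/\ {subset t <= s}, sparse t & forall q, q \in s ->
    exists u, [/\ {subset u <= t}, forall q', q' \in u -> (q.2 <= q'.2)%R &
      half_dense (box_union u) q.1]].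
Proof.
elim: s => [|h s IH] /= ps hs; first by exists [::].
have hs' q : q \in s -> proper_rect q.1 by move=> qs; apply: hs; rewrite inE qs orbT.
have hh : proper_rect h.1 by apply: hs; rewrite mem_head.
have [t [ts st ht]] := IH (path_sorted ps) hs'.
have hmin q : q \in s -> (h.2 <= q.2)%R.
  have tr : transitive (fun q q' : box * R => q.2 <= q'.2)%R.
    by move=> x y z; exact: le_trans.
  by have /allP := order_path_min tr ps; exact.
have [hd|hd] := pselect (half_dense (box_union t) h.1).
  exists t; split => //; first by move=> q /ts qs; rewrite inE qs orbT.
  move=> q; rewrite inE => /predU1P[->|/ht//].
  by exists t; split => // q' /ts; exact: hmin.
exists (h :: t); split.
- by move=> q; rewrite !inE => /predU1P[->|/ts ->]; rewrite ?eqxx ?orbT.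
- split => //.
  have mh := measurable_rectRn hh.
  have mT : measurable (box_union t : set (Rn R n)).
    by apply: borel_measurable_Rn; apply: measurable_box_union => q /ts; exact: hs'.
  have hv := rect_volume_gt0 hh.
  move/negP: hd; rewrite -ltNge lebesgueRn_rect// => hd.
  have e : (rect_volume h.1)%:E =
      mu (rect h.1 `\` box_union t) + mu (rect h.1 `&` box_union t).
    by rewrite -(lebesgueRn_rect hh); exact: measureDI.
  move: hd e; rewrite -EFinM.
  have fi : mu (rect h.1 `&` box_union t) \is a fin_num.
    rewrite ge0_fin_numE// (@le_lt_trans _ _ (mu (rect h.1)))//.
      by apply: le_measure; rewrite ?inE//; exact: measurableI.
    by rewrite lebesgueRn_rect// ltry.
  have fd : mu (rect h.1 `\` box_union t) \is a fin_num.
    rewrite ge0_fin_numE// (@le_lt_trans _ _ (mu (rect h.1)))//.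
      by apply: le_measure; rewrite ?inE//; exact: measurableD.
    by rewrite lebesgueRn_rect// ltry.
  rewrite -(fineK fi) -(fineK fd) -EFinD lte_fin lee_fin => hd [e].
  lra.
- move=> q; rewrite inE => /predU1P[->|/ht[u [ut uq hu]]].
    exists (h :: t); split => //.
      by move=> q'; rewrite inE => /predU1P[->//|/ts]; exact: hmin.
    rewrite /half_dense setIidl; last by rewrite /box_union seq_bigcup_cons; left.
    rewrite lebesgueRn_rect// -EFinM lee_fin; have := rect_volume_gt0 hh; lra.
  by exists u; split => // q' /ut q't; rewrite inE q't orbT.
Qed.

(** The parts of the rectangles outside the tails are disjoint and carry at least half of each
    volume, and [Phi] is at least [phi q] on the part that belongs to [q]. *)
Lemma sparse_sum (s : seq (box * R)) (phi : box * R -> \bar R) (Phi : 'rV[R]_n -> \bar R) :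
  sparse s -> (forall q, q \in s -> proper_rect q.1) ->
  measurable_fun [set: Rn R n] Phi -> (forall x, 0 <= Phi x) ->
  (forall q, q \in s -> 0 <= phi q) ->
  (forall q x, q \in s -> rect q.1 x -> phi q <= Phi x) ->
  \sum_(q <- s) (rect_volume q.1)%:E * phi q <= 2%:E * \int[mu]_x Phi x.
Proof.
move=> + + mPhi Phi0; move=> sp hs phi0 hphi.
apply: (@le_trans _ _ (2%:E * \int[mu]_(x in box_union s) Phi x)); last first.
  rewrite lee_wpmul2l// ge0_subset_integral//.
  by apply: borel_measurable_Rn; exact: measurable_box_union.
elim: s sp hs phi0 hphi => [|h t IH] /=.
  by move=> *; rewrite big_nil mule_ge0// integral_ge0.
move=> [hd sp] hs phi0 hphi.
have ht q : q \in t -> q \in h :: t by rewrite inE => ->; rewrite orbT.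
have hh : proper_rect h.1 by apply: hs; rewrite mem_head.
have mh := measurable_rectRn hh.
have mT : measurable (box_union t : set (Rn R n)).
  by apply: borel_measurable_Rn; apply: measurable_box_union => q /ht; exact: hs.
have mD : measurable (rect h.1 `\` box_union t : set (Rn R n)) by exact: measurableD.
have -> : box_union (h :: t) = (rect h.1 `\` box_union t) `|` box_union t.
  by rewrite /box_union seq_bigcup_cons setUDl setDv setD0.
rewrite big_cons ge0_integral_setU//; last 2 first.
- exact: measurable_funTS.
- by rewrite disj_set2E setDKI.
rewrite ge0_muleDr; [|exact: integral_ge0|exact: integral_ge0].
apply: leeD; last first.
  apply: IH => //.
  - by move=> q /ht; exact: hs.
  - by move=> q /ht; exact: phi0.
  - by move=> q x /ht; exact: hphi.
have p0 : 0 <= phi h by apply: phi0; rewrite mem_head.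
apply: (@le_trans _ _ (2%:E * (phi h * mu (rect h.1 `\` box_union t)))).
  rewrite [X in _ <= _ * X]muleC muleA lee_wpmul2r//.
  have h2 : 0 <= 2%:E :> \bar R by rewrite lee_fin.
  rewrite -lebesgueRn_rect//; have := lee_wpmul2l h2 hd.
  by rewrite muleA -EFinM divff// mul1e.
rewrite lee_wpmul2l// -integral_cst//; apply: ge0_le_integral => //.
- exact: measurable_funTS.
- by move=> x [hx _]; apply: hphi => //; rewrite mem_head.
Qed.

Lemma measurable_density_set c (A : set 'rV[R]_n) : measurable A ->
  measurable (density_set c A).
Proof.
by case: c => [//|c] mA; apply: measurable_bigcup_rect => r [[]].
Qed.

Lemma density_set_subset c (A B : set 'rV[R]_n) : measurable A -> measurable B ->
  A `<=` B -> density_set c A `<=` density_set c B.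
Proof.
case: c => [//|c] mA mB AB x [r [hr dr] rx]; exists r => //; split => //.
apply: le_trans dr _; have mr : measurable (rect r : set (Rn R n)).
  by apply: measurable_rectRn; case: hr.
apply: le_measure; rewrite ?inE.
- by apply: measurableI => //; exact: borel_measurable_Rn.
- by apply: measurableI => //; exact: borel_measurable_Rn.
- exact: setIS.
Qed.

(** The estimate (B_c) with constant [C]. *)
Definition density_bound c (C : R) :=
  forall (w : 'rV[R]_n -> \bar R) (A : set 'rV[R]_n),
    measurable_fun [set: Rn R n] w -> (forall x, 0 <= w x) -> measurable A ->
    \int[mu]_(x in density_set c A) w x <= C%:E * \int[mu]_(x in A) iter_maximal c w x.

(** A common [kappa] gives all rectangles of the list the same longest directions, as
    [sides_class_density] requires of a rectangle and the selected ones that half cover it. *)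
Lemma covering_class c (C : R) (kappa : 'I_n -> 'I_c.+1) (s : seq box)
    (w : 'rV[R]_n -> \bar R) :
  (0 <= C)%R -> density_bound c C ->
  measurable_fun [set: Rn R n] w -> (forall x, 0 <= w x) ->
  (forall r, r \in s -> exists L, sides_class kappa r L) ->
  exists t : seq (box * R), [/\ (forall q, q \in t -> q.1 \in s), sparse t &
    \int[mu]_(x in seq_bigcup (@rect R n) s) w x <=
      C%:E * \sum_(q <- t) \int[mu]_(x in rect (triple_rect q.1)) iter_maximal c w x].
Proof.
move=> C0 hC mw w0 hs.
have [L hL] : exists L : box -> R, forall r, r \in s -> sides_class kappa r (L r).
  have h r : exists l, r \in s -> sides_class kappa r l.
    by have [/hs[l hl]|_] := boolP (r \in s); [exists l|exists 0%R].
  by have [L hL] := choice h; exists L.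
pose S := sort (fun q q' : box * R => q.2 <= q'.2)%R [seq (r, L r) | r <- s].
have SE q : q \in S -> [/\ q.1 \in s, q.2 = L q.1 & sides_class kappa q.1 q.2].
  by rewrite mem_sort => /mapP[r rs ->]; split => //; exact: hL.
have hS q : q \in S -> proper_rect q.1 by move=> /SE[_ _ []].
have sS : sorted (fun q q' : box * R => q.2 <= q'.2)%R S.
  by apply: sort_sorted => q q'; exact: le_total.
have [t [tS st ht]] := sparse_selection sS hS.
have pt q : q \in t -> proper_rect q.1 by move=> /tS; exact: hS.
exists t; split => //; first by move=> q /tS /SE[].
have mv := measurable_iter_maximal c mw.
have v0 := iter_maximal_ge0 c w0.
have mT := measurable_triple_union pt.
have mD := borel_measurable_Rn (measurable_density_set c mT).
apply: (@le_trans _ _ (\int[mu]_(x in density_set c (triple_union t)) w x)).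
  apply: ge0_subset_integral => //.
  - by apply: measurable_seq_bigcup => r /hL[hr _]; exact: measurable_rectRn.
  - exact: measurable_funTS.
  move=> x /seq_bigcupP[r rs rx].
  have rS : (r, L r) \in S by rewrite mem_sort; apply/mapP; exists r.
  have [u [ut uL hu]] := ht _ rS.
  have pu q : q \in u -> proper_rect q.1 by move=> /ut; exact: pt.
  suff : density_set c (triple_union u) x.
    apply: density_set_subset => //; first exact: measurable_triple_union.
    exact: seq_bigcup_subset.
  apply: (sides_class_density (hL _ rs) _ hu rx) => q qu; split; last exact: uL.
  by have [] := SE _ (tS _ (ut _ qu)).
apply: le_trans (hC _ _ mw w0 mT) _; rewrite lee_wpmul2l ?lee_fin//.
apply: integral_seq_bigcup_le => // q /pt hq.
by apply: measurable_rectRn; exact: proper_triple_rect.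
Qed.

(** Any finite subfamily is split into the classes of the maps [kappa], of which there are
    [c.+1 ^ n]; the selection is made in each class separately. *)
Lemma covering c (C : R) (F : set box) (w : 'rV[R]_n -> \bar R) (M : \bar R) :
  (0 <= C)%R -> density_bound c C ->
  measurable_fun [set: Rn R n] w -> (forall x, 0 <= w x) ->
  (forall r, F r -> box_complexity c.+1 r) -> 0 <= M ->
  (forall t : seq (box * R), (forall q, q \in t -> F q.1) -> sparse t ->
    \sum_(q <- t) \int[mu]_(x in rect (triple_rect q.1)) iter_maximal c w x <= M) ->
  \int[mu]_(x in \bigcup_(r in F) rect r) w x <=
    ((c.+1 ^ n)%:R * C)%:E * M.
Proof.
move=> C0 hC mw w0 hF M0 hM.
have k0 : (0 <= (c.+1 ^ n)%:R * C)%R by rewrite mulr_ge0.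
apply: integral_bigcup_rect_le => //.
- by move=> r /hF[].
- by rewrite mule_ge0// lee_fin.
move=> s sF.
pose K : finType := {ffun 'I_n -> 'I_c.+1}.
pose cl (k : K) := [seq r <- s | `[< exists L, sides_class k r L >]].
have mcl k : measurable (seq_bigcup (@rect R n) (cl k) : set (Rn R n)).
  apply: measurable_seq_bigcup => r; rewrite mem_filter => /andP[/asboolP[L [hr _]] _].
  exact: measurable_rectRn.
apply: (@le_trans _ _ (\int[mu]_(x in seq_bigcup (fun k => seq_bigcup (@rect R n) (cl k)) (index_enum K)) w x)).
  apply: ge0_subset_integral => //.
  - apply: measurable_seq_bigcup => r /sF /hF[hr _]; exact: measurable_rectRn.
  - exact: measurable_seq_bigcup.
  - exact: measurable_funTS.
  move=> x /seq_bigcupP[r rs rx].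
  have [k [L hk]] := box_complexity_sides (hF _ (sF _ rs)).
  apply/seq_bigcupP; exists k; first by rewrite mem_index_enum.
  apply/seq_bigcupP; exists r => //; rewrite mem_filter rs andbT.
  by apply/asboolP; exists L.
apply: le_trans (integral_seq_bigcup_le _ mw w0) _ => //.
apply: (@le_trans _ _ (\sum_(k : K) (C%:E * M))).
  apply: lee_sum => k _.
  have [|t [ts st ht]] := @covering_class c C k (cl k) w C0 hC mw w0.
    by move=> r; rewrite mem_filter => /andP[/asboolP].
  apply: le_trans ht _; rewrite lee_wpmul2l ?lee_fin//; apply: hM => // q /ts.
  by rewrite mem_filter => /andP[_ /sF].
rewrite (eq_bigr (fun _ => 1%:E * (C%:E * M))); last by move=> k _; rewrite mul1e.
rewrite -ge0_sume_distrl// sumEFin sumr_const card_ffun !card_ord EFinM -muleA.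
by [].
Qed.

End Covering.

(** * The weighted inequality *)

Section WeightedBound.
Context {R : realType} {n : nat}.
Local Open Scope ereal_scope.
Local Notation mu := (@lebesgueRn R n).
Local Notation box := ('rV[R]_n * 'rV[R]_n)%type.

Lemma prod_powR m (th : 'I_m -> R) (a : R) : (0 < a)%R ->
  (\prod_(j < m) a `^ th j = a `^ (\sum_(j < m) th j))%R.
Proof.
move=> a0; rewrite [RHS]/powR gt_eqF// mulr_suml expR_sum.
by apply: eq_bigr => j _; rewrite /powR gt_eqF.
Qed.

Lemma prod_poweR_weights m (th : 'I_m -> R) (a : R) : (0 < a)%R ->
  (\sum_(j < m) th j = 1)%R -> \prod_(j < m) (a%:E `^ th j) = a%:E.
Proof.
move=> a0 th1; under eq_bigr do rewrite poweR_EFin.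
by rewrite prode_fin//= prod_powR// th1 powRr1// ltW.
Qed.

Lemma average_le (f g : 'rV[R]_n -> \bar R) (r : box) : proper_rect r ->
  measurable_fun [set: Rn R n] f -> measurable_fun [set: Rn R n] g ->
  (forall x, 0 <= f x) -> (forall x, rect r x -> f x <= g x) ->
  (forall x, 0 <= g x) -> average f (rect r) <= average g (rect r).
Proof.
move=> hr mf mg f0 fg g0; rewrite !average_rect//; apply: lee_wpmul2l.
  by rewrite lee_fin invr_ge0 ltW// rect_volume_gt0.
apply: ge0_le_integral => //.
- exact: measurable_rectRn.
- exact: measurable_funTS.
- exact: measurable_funTS.
Qed.

(** The exponents have sum 1, so the factor [1 / |r|] distributes over the product and Hoelder's
    inequality holds for averages. *)
Lemma average_prod m (th : 'I_m -> R) (F : 'I_m -> 'rV[R]_n -> \bar R) (r : box) :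
  proper_rect r -> (forall j, 0 < th j)%R -> (\sum_(j < m) th j = 1)%R ->
  (forall j, measurable_fun [set: Rn R n] (F j)) -> (forall j x, 0 <= F j x) ->
  average (fun x => \prod_(j < m) F j x `^ th j) (rect r) <=
    \prod_(j < m) average (F j) (rect r) `^ th j.
Proof.
move=> hr th0 th1 mF F0; have v0 := rect_volume_gt0 hr.
have vi0 : (0 < (rect_volume r)^-1)%R by rewrite invr_gt0.
rewrite average_rect//; last by move=> x; apply: prode_ge0 => j _; exact: poweR_ge0.
have -> : \prod_(j < m) average (F j) (rect r) `^ th j =
    ((rect_volume r)^-1)%:E * \prod_(j < m) (\int[mu]_(x in rect r) F j x) `^ th j.
  rewrite -[X in _ = X * _](prod_poweR_weights vi0 th1) -big_split/=.
  apply: eq_bigr => j _; rewrite average_rect// poweRM//; first by rewrite lee_fin ltW.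
  exact: integral_ge0.
apply: lee_wpmul2l; first by rewrite lee_fin ltW.
apply: holder_prod => //; first exact: measurable_rectRn.
by move=> j; exact: measurable_funTS.
Qed.

Lemma measurable_prod_poweR m (th : 'I_m -> R) (F : 'I_m -> 'rV[R]_n -> \bar R) :
  (forall j, measurable_fun [set: Rn R n] (F j)) ->
  measurable_fun [set: Rn R n] (fun x => \prod_(j < m) F j x `^ th j).
Proof. by move=> mF; apply: emeasurable_prod => j; exact: emeasurable_powR. Qed.

Lemma prod_poweR_ge0 m (th : 'I_m -> R) (x : 'I_m -> \bar R) :
  0 <= \prod_(j < m) x j `^ th j.
Proof. by apply: prode_ge0 => j _; exact: poweR_ge0. Qed.

Lemma le_prod_poweR m (th : 'I_m -> R) (x y : 'I_m -> \bar R) :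
  (forall j, 0 < th j)%R -> (forall j, 0 <= x j) -> (forall j, x j <= y j) ->
  \prod_(j < m) x j `^ th j <= \prod_(j < m) y j `^ th j.
Proof.
move=> th0 x0 xy; apply: le_prode => j; first exact: poweR_ge0.
by apply: lee_poweR => //; exact: ltW.
Qed.

(** Hoelder's inequality on each rectangle, after which every factor is bounded by its own supremum;
    each further maximal operator repeats the argument. This separates the iterated maximal function
    of the product weight into those of the single weights. *)
Lemma iter_maximal_prod c m (th : 'I_m -> R) (w : 'I_m -> 'rV[R]_n -> \bar R) x :
  (forall j, 0 < th j)%R -> (\sum_(j < m) th j = 1)%R ->
  (forall j, measurable_fun [set: Rn R n] (w j)) -> (forall j x, 0 <= w j x) ->
  iter_maximal c (fun y => \prod_(j < m) w j y `^ th j) x <=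
    \prod_(j < m) iter_maximal c (w j) x `^ th j.
Proof.
move=> th0 th1 mw w0; elim: c x => [x|c IH x]; first exact: lexx.
rewrite iter_maximalS; apply: ge_ereal_sup => _ [Q [/rectangles_complexityP[r hr ->] rx] <-].
have hpr : proper_rect r by case: hr.
have v0 j y : 0 <= iter_maximal c (w j) y by exact: iter_maximal_ge0.
have mv j : measurable_fun [set: Rn R n] (iter_maximal c (w j)) by exact: measurable_iter_maximal.
have m0 := @prod_poweR_ge0 m th.
apply: le_trans (average_le hpr _ _ _ (fun y _ => IH y) _) _.
- by apply: measurable_iter_maximal; exact: measurable_prod_poweR.
- exact: measurable_prod_poweR.
- by apply: iter_maximal_ge0 => y.
- by move=> y.
apply: le_trans (average_prod hpr th0 th1 mv v0) _.
apply: le_prod_poweR => // j; first exact: average_ge0.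
by rewrite iter_maximalS; exact: average_le_strong_maximal.
Qed.

(* The average of [v] over the triple is at most [strong_maximal c.+1 v] at
   each point of [r]. *)
Lemma weighted_average_le c (q : R) (f v : 'rV[R]_n -> \bar R) (r : box) :
  (0 < q)%R -> box_complexity c.+1 r ->
  measurable_fun [set: Rn R n] f -> (forall x, 0 <= f x) ->
  average v (rect (triple_rect r)) `^ q^-1 * average f (rect r) <=
    average (fun x => f x * strong_maximal c.+1 v x `^ q^-1) (rect r).
Proof.
move=> q0 hr mf f0; have hpr : proper_rect r by case: hr.
have hpt := proper_triple_rect hpr.
have mr := measurable_rectRn hpr.
have mW : measurable_fun [set: Rn R n] (fun x => f x * strong_maximal c.+1 v x `^ q^-1).
  apply: (emeasurable_funM mf); apply: emeasurable_powR.
  by apply: borel_measurable_fun_Rn; exact: measurable_strong_maximal.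
have W0 x : 0 <= f x * strong_maximal c.+1 v x `^ q^-1 by rewrite mule_ge0// poweR_ge0.
set k := average v (rect (triple_rect r)) `^ q^-1.
have k0 : 0 <= k by exact: poweR_ge0.
rewrite !average_rect// muleCA; apply: lee_wpmul2l.
  by rewrite lee_fin invr_ge0 ltW// rect_volume_gt0.
rewrite -(ge0_integralZl mu mr (measurable_funTS mf) (fun x _ => f0 x) k0).
apply: ge0_le_integral.
- exact: mr.
- by move=> x _; exact: mule_ge0.
- by apply: measurable_funeM; exact: measurable_funTS.
- exact: measurable_funTS.
move=> x rx; rewrite muleC; apply: lee_wpmul2l; first exact: f0.
apply: lee_poweR.
- by rewrite invr_ge0 ltW.
- exact: average_ge0.
- by apply: average_le_strong_maximal;
    [exact: box_complexity_triple|exact: sub_triple_rect].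
Qed.

Local Opaque iter_maximal average.

Lemma weighted_bound c (C : R) m (ps : 'I_m -> R) (p : R) :
  (0 < m)%N -> (forall j, 1 < ps j)%R -> (p^-1 = \sum_(j < m) (ps j)^-1)%R ->
  (0 <= C)%R -> @density_bound R n c C ->
  exists2 K : R, (0 <= K)%R &
  forall (w f : 'I_m -> 'rV[R]_n -> \bar R) (F : set box),
    (forall j, measurable_fun [set: Rn R n] (w j)) -> (forall j x, 0 <= w j x) ->
    (forall j, measurable_fun [set: Rn R n] (f j)) -> (forall j x, 0 <= f j x) ->
    (forall r, F r -> box_complexity c.+1 r) ->
    (forall r, F r -> 1 <= \prod_(j < m) average (f j) (rect r)) ->
    \int[mu]_(x in \bigcup_(r in F) rect r) (\prod_(j < m) w j x `^ (p / ps j)) <=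
      K%:E * \prod_(j < m)
        (\int[mu]_x (f j x `^ ps j * iter_maximal c.+1 (w j) x)) `^ (p / ps j).
Proof.
move=> m0 ps1 hp C0 hC.
have ps0 j : (0 < ps j)%R by rewrite (lt_trans ltr01).
have p0 : (0 < p)%R.
  rewrite -invr_gt0 hp; case: m m0 ps {ps1} ps0 {hp} => // m _ ps ps0.
  rewrite big_ord_recl ltr_pwDl ?invr_gt0//.
  by apply: sumr_ge0 => j _; rewrite invr_ge0 ltW.
pose th j := (p / ps j)%R.
have th0 j : (0 < th j)%R by rewrite divr_gt0.
have th1 : (\sum_(j < m) th j = 1)%R by rewrite -mulr_sumr -hp divff// gt_eqF.
have /choice[K hK] : forall j, exists k, (0 <= k)%R /\
   forall (g : 'rV[R]_n -> \bar R) (s : seq box),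
  measurable_fun [set: Rn R n] g -> (forall x, 0 <= g x) ->
  (forall r, r \in s -> proper_rect r) ->
  \int[mu]_x (\big[maxe/0]_(r <- s) ((\1_(rect r) x)%:E * average g (rect r))) `^ ps j
  <= k%:E * \int[mu]_x (g x `^ ps j).
  by move=> j; have [k k0 hk] := @strong_maximal_finite R n (ps j) (ps1 j); exists k.
pose KK := (\prod_(j < m) K j `^ th j)%R.
have KK0 : (0 <= KK)%R by apply: prodr_ge0 => j _; exact: powR_ge0.
(* The first two factors come from [covering], [3 ^+ n] from the volume of the triples, 2 from
   [sparse_sum], and [KK] from the maximal theorem in the spaces with exponents [ps j]. *)
exists ((c.+1 ^ n)%:R * C * (3 ^+ n * 2 * KK))%R.
  by rewrite !mulr_ge0// exprn_ge0.
move=> w f F mw w0 mf f0 hF hF1.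
pose W j := iter_maximal c.+1 (w j).
have W0 j x : 0 <= W j x by exact: iter_maximal_ge0.
have mW j : measurable_fun [set: Rn R n] (W j) by exact: measurable_iter_maximal.
(* The weight is moved into the function: [g j ^ ps j] is [f j ^ ps j] times [W j], so the
   unweighted maximal theorem for [g j] yields the weighted norm of [f j]. *)
pose g j x := f j x * W j x `^ (ps j)^-1.
have g0 j x : 0 <= g j x by rewrite mule_ge0// poweR_ge0.
have mg j : measurable_fun [set: Rn R n] (g j).
  exact: (emeasurable_funM (mf j) (emeasurable_powR _ (mW j))).
have gE j x : g j x `^ ps j = f j x `^ ps j * W j x.
  rewrite poweRM ?poweR_ge0//; congr (_ * _).
  by rewrite -poweRrM mulVf ?gt_eqF// poweRe1.
set P := \prod_(j < m) _.
have P0 : 0 <= P by exact: prod_poweR_ge0.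
have PE : P = \prod_(j < m) (\int[mu]_x (g j x `^ ps j)) `^ th j.
  by apply: eq_bigr => j _; congr (_ `^ _); apply: eq_integral => x _; rewrite gE.
rewrite EFinM -muleA; apply: (covering C0 hC).
- exact: (measurable_prod_poweR th mw).
- by move=> x; exact: prod_poweR_ge0.
- exact: hF.
- by rewrite mule_ge0// lee_fin !mulr_ge0// exprn_ge0.
move=> t tF st.
have ht q : q \in t -> proper_rect q.1 by move=> /tF /hF[].
pose G j x := \big[maxe/0]_(r <- map fst t) ((\1_(rect r) x)%:E * average (g j) (rect r)).
have hs r : r \in map fst t -> proper_rect r by move=> /mapP[q /ht hq ->].
have G0 j x : 0 <= G j x by exact: seq_max_ge0.
have mG j : measurable_fun [set: Rn R n] (G j).
  apply: measurable_seq_max => r /hs hr; apply: emeasurable_funM; last exact: measurable_cst.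
  by apply: measurable_indicE; exact: measurable_rectRn.
(* The product of the p-th powers of the averages, with the exponent split as [p = ps j * th j]: the
   outer part is for Hoelder's inequality, the inner one for the maximal theorem. *)
pose phi (q : box * R) := \prod_(j < m) (average (g j) (rect q.1) `^ ps j) `^ th j.
pose Phi x := \prod_(j < m) (G j x `^ ps j) `^ th j.
have mPhi : measurable_fun [set: Rn R n] Phi.
  by apply: measurable_prod_poweR => j; exact: emeasurable_powR.
have step q : q \in t -> \int[mu]_(x in rect (triple_rect q.1))
     iter_maximal c (fun y => \prod_(j < m) w j y `^ th j) x <=
     (3 ^+ n)%:E * ((rect_volume q.1)%:E * phi q).
  move=> qt; have hq := ht _ qt; have hcq := hF _ (tF _ qt).
  have hq3 := proper_triple_rect hq; have v3 := rect_volume_gt0 hq3.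
  set V := iter_maximal c _.
  have V0 x : 0 <= V x by apply: iter_maximal_ge0 => y; exact: prod_poweR_ge0.
  have mV : measurable_fun [set: Rn R n] V.
    by apply: measurable_iter_maximal; exact: measurable_prod_poweR.
  have -> : \int[mu]_(x in rect (triple_rect q.1)) V x =
      (rect_volume (triple_rect q.1))%:E * average V (rect (triple_rect q.1)).
    by rewrite average_rect// muleA -EFinM divff ?mul1e// gt_eqF.
  rewrite rect_volume_triple EFinM -muleA lee_wpmul2l ?lee_fin ?exprn_ge0//.
  rewrite lee_wpmul2l ?lee_fin ?(ltW (rect_volume_gt0 hq))//.
  pose v j := iter_maximal c (w j).
  have v0 j x : 0 <= v j x by exact: iter_maximal_ge0.
  have mv j : measurable_fun [set: Rn R n] (v j) by exact: measurable_iter_maximal.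
  pose a j := average (v j) (rect (triple_rect q.1)).
  have a0 j : 0 <= a j by exact: average_ge0.
  pose A j := average (f j) (rect q.1).
  have A0 j : 0 <= A j by exact: average_ge0.
  have VP : average V (rect (triple_rect q.1)) <= \prod_(j < m) a j `^ th j.
    apply: le_trans (average_prod hq3 th0 th1 mv v0).
    apply: (average_le hq3 mV _ V0).
    - exact: (measurable_prod_poweR th mv).
    - by move=> x _; exact: (iter_maximal_prod c x th0 th1 mw w0).
    - by move=> x; exact: prod_poweR_ge0.
  apply: (le_trans VP).
  (* The level condition on [F] enters here: a factor that is at least 1 may be inserted, and its
     power [p] matches the weights [a j ^ th j]. *)
  have AP : 1 <= (\prod_(j < m) A j) `^ p.
    rewrite -[leLHS](poweR1r p); apply: lee_poweR; [exact: ltW|by []|].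
    exact: hF1 (tF _ qt).
  apply: (@le_trans _ _ ((\prod_(j < m) a j `^ th j) * (\prod_(j < m) A j) `^ p)).
    by rewrite -[leLHS]mule1 lee_wpmul2l// prod_poweR_ge0.
  rewrite poweR_prod// -big_split/=; apply: le_prode => j.
    by rewrite mule_ge0// poweR_ge0.
  have e : p = (ps j * th j)%R by rewrite mulrCA divff ?mulr1// gt_eqF.
  have -> : a j `^ th j * A j `^ p = ((a j `^ (ps j)^-1 * A j) `^ ps j) `^ th j.
    rewrite -poweRrM -e poweRM ?poweR_ge0//; congr (_ * _).
    by rewrite -poweRrM; congr (_ `^ _); rewrite /th mulrC.
  apply: lee_poweR; [exact: ltW|exact: poweR_ge0|].
  apply: lee_poweR; [exact: ltW|by rewrite mule_ge0// poweR_ge0|].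
  apply: le_trans (weighted_average_le _ (ps0 j) hcq (mf j) (f0 j)) _.
  by rewrite /g /W iter_maximalS.
apply: (@le_trans _ _ ((3 ^+ n)%:E * (2%:E * \int[mu]_x Phi x))).
  apply: (@le_trans _ _ (\sum_(q <- t) ((3 ^+ n)%:E * ((rect_volume q.1)%:E * phi q)))).
    by rewrite big_seq [leRHS]big_seq; apply: lee_sum => q; exact: step.
  have phi0 q : 0 <= phi q by exact: prod_poweR_ge0.
  rewrite big_seq -ge0_sume_distrr; last first.
    by move=> q /ht hq; rewrite mule_ge0// lee_fin ltW// rect_volume_gt0.
  rewrite -big_seq lee_wpmul2l ?lee_fin ?exprn_ge0//.
  apply: sparse_sum => //; first by move=> x; exact: prod_poweR_ge0.
  move=> q x qt rx; apply: le_prod_poweR => // j; first exact: poweR_ge0.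
  apply: lee_poweR; [exact: ltW|by apply: average_ge0; exact: ht|].
  apply: le_trans (seq_max_ge _ (map_f fst qt)).
  by rewrite indicE mem_set// mul1e.
rewrite muleA -EFinM [leRHS](_ : _ = (3 ^+ n * 2)%:E * (KK%:E * P)); last first.
  by rewrite EFinM muleA.
rewrite lee_wpmul2l ?lee_fin ?mulr_ge0 ?exprn_ge0//.
apply: le_trans (holder_prod mu measurableT th0 th1 (F := fun j x => G j x `^ ps j) _ _) _.
- by move=> j; exact: emeasurable_powR.
- by move=> j x; exact: poweR_ge0.
have -> : KK%:E = \prod_(j < m) (K j)%:E `^ th j.
  under eq_bigr do rewrite poweR_EFin.
  by rewrite prode_fin.
rewrite PE -big_split/=; apply: le_prode => j; first exact: poweR_ge0.
rewrite -poweR_EFin -poweRM; last 2 first.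
- by rewrite lee_fin; have [] := hK j.
- by apply: integral_ge0 => x _; exact: poweR_ge0.
apply: lee_poweR; [exact: ltW|by apply: integral_ge0 => x _; exact: poweR_ge0|].
by have [_ h] := hK j; exact: h.
Qed.

Local Transparent iter_maximal average.

End WeightedBound.

(** * Induction on the complexity *)

Section DensityBound.
Context {R : realType} {n : nat}.
Local Open Scope ereal_scope.
Local Notation mu := (@lebesgueRn R n).
Local Notation box := ('rV[R]_n * 'rV[R]_n)%type.

Lemma density_bound_exists c : exists2 C : R, (0 <= C)%R & @density_bound R n c C.
Proof.
elim: c => [|c [C C0 hC]].
  by exists 1%R => // w A mw w0 mA; rewrite mul1e.
(* The exponent 2 is an arbitrary choice above 1; the factor 4 of the constant is the square of the
   value 2 of [f] on [A]. *)
have hp : ((2 : R)^-1 = \sum_(j < 1) 2^-1)%R by rewrite big_ord1.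
have [K K0 hK] := weighted_bound (ps := fun _ : 'I_1 => 2%R) (ltn0Sn 0) (fun _ => ltr1n _ 2) hp C0 hC.
exists (K * 4)%R; first by rewrite mulr_ge0.
move=> w A mw w0 mA.
have mA' := borel_measurable_Rn mA.
pose f (j : 'I_1) (x : 'rV[R]_n) := 2%:E * (\1_A x : R)%:E.
have f0 j x : 0 <= f j x by rewrite mule_ge0// lee_fin.
have mf j : measurable_fun [set: Rn R n] (f j).
  by apply: measurable_funeM; exact: measurable_indicE.
have := hK (fun _ => w) f [set r | box_complexity c.+1 r /\ half_dense A r]
  (fun _ => mw) (fun _ => w0) mf f0 (fun r => @proj1 _ _).
have W0 : forall x, 0 <= iter_maximal c.+1 w x by exact: iter_maximal_ge0.
have mW := measurable_iter_maximal c.+1 mw.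
move: W0 mW; move: (iter_maximal c.+1 w) => M M0 mM.
have mAM : measurable_fun [set: Rn R n] (fun x => (\1_A x : R)%:E * M x).
  exact: (emeasurable_funM (measurable_indicE (borel_measurable_Rn mA)) mM).
have AM0 x : 0 <= (\1_A x : R)%:E * M x by rewrite mule_ge0// lee_fin.
rewrite !big_ord1 divff ?pnatr_eq0// poweRe1; last first.
  by apply: integral_ge0 => x _; rewrite mule_ge0// poweR_ge0.
have -> : \int[mu]_x (f ord0 x `^ 2 * M x) = 4%:E * \int[mu]_(x in A) M x.
  have h4 : 0 <= 4%:E :> \bar R by rewrite lee_fin.
  rewrite (integral_indicM mu A M).
  rewrite -(ge0_integralZl mu measurableT mAM (fun x _ => AM0 x) h4).
  apply: eq_integral => x _; rewrite /f indicE; case: (x \in A).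
    rewrite mule1 mul1e poweR_EFin; congr (_%:E * _).
    by rewrite powR_mulrn// expr2; lra.
  by rewrite mule0 mul0e poweR0r ?mule0// ?mul0e.
rewrite muleA -EFinM => h.
rewrite [leLHS](_ : _ = \int[mu]_(x in \bigcup_(r in [set r | box_complexity c.+1 r /\ half_dense A r]) rect r)
   \prod_(j < 1) w x `^ 1); last first.
  by apply: eq_integral => x _; rewrite big_ord1 poweRe1.
(* Half density of [A] in [r] says that the average of twice its indicator is at least 1. *)
apply: h => r [[hr _] hd]; rewrite big_ord1 average_rect//.
have mr := measurable_rectRn hr.
have h2 : 0 <= 2%:E :> \bar R by rewrite lee_fin.
have i0 x : 0 <= (\1_A x : R)%:E by rewrite lee_fin.
have mi : measurable_fun [set: Rn R n] (fun x => (\1_A x : R)%:E) by exact: measurable_indicE.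
rewrite (ge0_integralZl mu mr (measurable_funTS mi) (fun x _ => i0 x) h2).
rewrite integral_indic// -lee_pdivrMl ?invr_gt0 ?rect_volume_gt0// invrK mule1.
rewrite setIC; move: hd; rewrite /half_dense lebesgueRn_rect// => hd.
by have := lee_wpmul2l h2 hd; rewrite -!EFinM mulrA divff// mul1r.
Qed.

End DensityBound.

Theorem theorem1p2 (R : realType) (m n : nat) (hm : (1 <= m)%N) (hn : (1 <= n)%N)
    (ps : 'I_m -> R) (hps : forall j, 1 < ps j)
    (p : R) (hp : p^-1 = \sum_(j < m) (ps j)^-1) :
  exists C : R, 0 < C /\
    forall (w : 'I_m -> 'rV[R]_n -> R) (f : 'I_m -> 'rV[R]_n -> R) (t : R),
      (forall j, weight (w j)) ->
      (forall j, locally_integrableRn (f j)) ->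
      0 < t ->
      ((weight_measure (product_weight p ps w)
          [set x | (t ^+ m)%:E < multilinear_maximal f x]) `^ p^-1
        <= \prod_(j < m) ((C / t)%:E *
             weighted_norm (ps j) (iterated_maximal (EFin \o w j)) (f j)))%E.
Proof.
(* Arbitrary rectangles have complexity [n = c + 1], so the density bound is used at complexity
   [n - 1]. *)
case: n hn => // c _.
have ps0 j : 0 < ps j by rewrite (lt_trans ltr01).
have p0 : 0 < p.
  rewrite -invr_gt0 hp; case: m hm ps {hps hp} ps0 => // m _ ps ps0.
  rewrite big_ord_recl ltr_pwDl ?invr_gt0//.
  by apply: sumr_ge0 => j _; rewrite invr_ge0 ltW.
have [B B0 hB] := @density_bound_exists R c.+1 c.
have [K K0 hK] := weighted_bound hm hps hp B0 hB.
(* [C] occurs once in each of the [m] factors, and [C >= 1] with [m >= 1] gives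
   [C ^ m >= C >= K ^ (1 / p)]. *)
pose C : R := 1 + K `^ p^-1.
have C1 : 1 <= C by rewrite lerDl powR_ge0.
have C0 : 0 < C by rewrite (lt_le_trans ltr01).
exists C; split => // w f t hw hf t0.
have ti0 : 0 <= t^-1 by rewrite invr_ge0 ltW.
pose ew j (x : 'rV[R]_c.+1) := (w j x)%:E.
(* Division by [t] normalises the level [t ^ m] to the level 1 of [weighted_bound]. *)
pose g j (x : 'rV[R]_c.+1) := ((t^-1)%:E * `|(f j x)%:E|)%E.
have ew0 j x : (0 <= ew j x)%E by rewrite lee_fin; have [] := hw j.
have mew j : measurable_fun [set: Rn R c.+1] (ew j).
  by apply/measurable_EFinP; have [_ []] := hw j.
have g0 j x : (0 <= g j x)%E by rewrite mule_ge0// lee_fin.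
have maf j : measurable_fun [set: Rn R c.+1] (fun x => `|(f j x)%:E|%E).
  have mEf : measurable_fun [set: Rn R c.+1] (EFin \o f j).
    by apply/measurable_EFinP; have [] := hf j.
  exact: (measurableT_comp (abse_measurable (D := setT)) mEf).
have mg j : measurable_fun [set: Rn R c.+1] (g j) by exact: measurable_funeM.
pose F := [set r : 'rV[R]_c.+1 * 'rV[R]_c.+1 | box_complexity c.+1 r /\
   ((t ^+ m)%:E < \prod_(j < m) average (EFin \o f j) (rect r))%E].
have FE : [set x | ((t ^+ m)%:E < multilinear_maximal f x)%E] = \bigcup_(r in F) rect r.
  apply/seteqP; split => [x /ereal_sup_gt[_ [Q [/rectanglesP[r hr ->] rx] <-] tr]|x [r [hr tr] rx]].
    by exists r.
  apply: (lt_le_trans tr); apply: ereal_sup_ubound; exists (rect r) => //; split => //.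
  by case: hr => hr _; exists r.1, r.2.
have avE j r : proper_rect r ->
    average (g j) (rect r) = ((t^-1)%:E * average (EFin \o f j) (rect r))%E.
  move=> hr; rewrite (average_rect hr (g0 j)) /g.
  rewrite (ge0_integralZl (@lebesgueRn R c.+1) (measurable_rectRn hr)
    (measurable_funTS (maf j)) (fun x _ => abse_ge0 _)); last by rewrite lee_fin.
  rewrite /average lebesgueRn_rect// inver gt_eqF ?rect_volume_gt0//.
  by rewrite muleCA.
have := hK ew g F mew ew0 mg g0 (fun r => @proj1 _ _).
move=> /(_ _)/wrap[r [[hr _] tr]|h].
  rewrite (eq_bigr (fun j => ((t^-1)%:E * average (EFin \o f j) (rect r))%E)); last first.
    by move=> j _; rewrite avE.
  rewrite big_split/= prode_fin//= prodr_const card_ord exprVn.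
  by rewrite -lee_pdivrMl ?invr_gt0 ?exprn_gt0// invrK mule1 ltW.
rewrite /weight_measure FE.
have -> : (\int[@lebesgueRn R c.+1]_(x in \bigcup_(r in F) rect r) (product_weight p ps w x)%:E =
   \int[@lebesgueRn R c.+1]_(x in \bigcup_(r in F) rect r) \prod_(j < m) ew j x `^ (p / ps j))%E.
  apply: eq_integral => x _; rewrite /product_weight prode_fin; last first.
    by move=> j; exact: fin_num_poweR.
  by congr EFin; apply: eq_bigr => j _; rewrite fine_poweR.
set N := fun j => weighted_norm (ps j) (iterated_maximal (EFin \o w j)) (f j).
have N0 j : (0 <= N j)%E by exact: poweR_ge0.
have W0 j x : (0 <= iter_maximal c.+1 (ew j) x)%E by exact: iter_maximal_ge0.
have mW j : measurable_fun [set: Rn R c.+1] (iter_maximal c.+1 (ew j)).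
  exact: measurable_iter_maximal.
have NE j : ((\int[@lebesgueRn R c.+1]_x (g j x `^ ps j * iter_maximal c.+1 (ew j) x))
    `^ (ps j)^-1 = (t^-1)%:E * N j)%E.
  have mI : measurable_fun [set: Rn R c.+1]
      (fun x => ((`|f j x| `^ ps j)%:E * iter_maximal c.+1 (ew j) x)%E).
    apply: (fun h => emeasurable_funM h (mW j)).
    have := emeasurable_powR (ps j) (maf j).
    by under eq_fun do rewrite abse_EFin poweR_EFin.
  have I0 x : (0 <= (`|f j x| `^ ps j)%:E * iter_maximal c.+1 (ew j) x)%E.
    by rewrite mule_ge0// lee_fin powR_ge0.
  have -> : (\int[@lebesgueRn R c.+1]_x (g j x `^ ps j * iter_maximal c.+1 (ew j) x) =
      \int[@lebesgueRn R c.+1]_x ((t^-1)%:E `^ ps j *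
        ((`|f j x| `^ ps j)%:E * iter_maximal c.+1 (ew j) x)))%E.
    by apply: eq_integral => x _; rewrite /g poweRM// -muleA abse_EFin !poweR_EFin.
  have c0 : (0 <= (t^-1)%:E `^ ps j)%E by exact: poweR_ge0.
  rewrite (ge0_integralZl (@lebesgueRn R c.+1) measurableT mI (fun x _ => I0 x) c0).
  rewrite poweRM ?poweR_ge0//; last exact: integral_ge0.
  by rewrite poweRK ?gt_eqF.
apply: (@le_trans _ _ ((K%:E * \prod_(j < m)
    (\int[@lebesgueRn R c.+1]_x (g j x `^ ps j * iter_maximal c.+1 (ew j) x)) `^ (p / ps j)) `^ p^-1)%E).
  apply: lee_poweR => //; first by rewrite invr_ge0 ltW.
  by apply: integral_ge0 => x _; exact: prod_poweR_ge0.
rewrite poweRM ?lee_fin//; last exact: prod_poweR_ge0.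
rewrite poweR_prod; last by move=> j; exact: poweR_ge0.
rewrite (eq_bigr (fun j => (t^-1)%:E * N j)%E); last first.
  move=> j _; rewrite -NE -poweRrM; congr (_ `^ _)%E.
  by rewrite mulrAC divff ?mul1r// gt_eqF.
rewrite [leRHS](eq_bigr (fun j => C%:E * ((t^-1)%:E * N j))%E); last first.
  by move=> j _; rewrite EFinM muleA.
rewrite [leRHS]big_split; apply: lee_pmul; [exact: poweR_ge0| | |exact: lexx].
  by apply: prode_ge0 => j _; rewrite mule_ge0.
rewrite prode_fin//= prodr_const card_ord lee_fin.
apply: (@le_trans _ _ C); first by rewrite lerDr.
by rewrite -[leLHS]expr1; apply: ler_weXn2l.
Qed.
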